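(* Let $R$ be a separative exchange ring and let $A$ be a (von Neumann) regular $n\times n$ matrix over $R$, i.e. there exists $B\in M_n(R)$ with $ABA=A$. Then $A$ can be transformed into a diagonal matrix by a finite sequence of elementary row and column operations.
   Context: All rings are unital and modules are right modules. A ring $R$ is an exchange ring if for every $a\in R$ there is an idempotent $e\in aR$ with $1-e\in(1-a)R$ (equivalently, $R_R$ has the finite exchange property). $R$ is separative if for all finitely generated projective right $R$-modules $P,Q$: $P\oplus P\cong P\oplus Q\cong Q\oplus Q$ implies $P\cong Q$. An elementary row (resp. column) operation adds a left (resp. right) multiple by an element of $R$ of one row (resp. column) to a different row (resp. column); equivalently, multiplying on the left (resp. right) by a transvection $I+re_{ij}$, $i\ne j$. *)

(* Defs.v *)
From HB Require Import structures.
From mathcomp Require Import all_boot all_order all_algebra.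
Set Implicit Arguments. Unset Strict Implicit. Unset Printing Implicit Defensive.
Import GRing.Theory.
Local Open Scope ring_scope.

(* Rings are unital (pzRingType: possibly-zero unital ring).  Right R-modules
   are modeled as left modules over the converse ring R^c. *)
Notation rmodType R := (lmodType (R^c)).

Definition exchange_ring (R : pzRingType) : Prop :=
  forall a : R, exists e : R,
    [/\ e * e = e, (exists r : R, e = a * r) & (exists s : R, 1 - e = (1 - a) * s)].

Definition mod_iso (R : pzRingType) (M N : rmodType R) : Prop :=
  exists f : M -> N, linear f /\ bijective f.

(* Finitely generated projective right R-module: a direct summand of R^n, i.e.
   there are linear f : R^n -> P and g : P -> R^n with f \o g = id.
   Here R^n is the row space 'rV[R^c]_n, on which R acts on the right. *)
Definition fg_projective (R : pzRingType) (P : rmodType R) : Prop :=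
  exists n : nat, exists (f : 'rV[R^c]_n -> P) (g : P -> 'rV[R^c]_n),
    [/\ linear f, linear g & cancel g f].

Definition separative (R : pzRingType) : Prop :=
  forall P Q : rmodType R, fg_projective P -> fg_projective Q ->
    mod_iso (P * P)%type (P * Q)%type -> mod_iso (P * Q)%type (Q * Q)%type ->
    mod_iso P Q.

Definition transvection (R : pzRingType) (n : nat) (i j : 'I_n) (r : R) : 'M[R]_n :=
  1%:M + r *: delta_mx i j.

Inductive elem_reach (R : pzRingType) (n : nat) : 'M[R]_n -> 'M[R]_n -> Prop :=
  | er_refl A : elem_reach A A
  | er_row A B (i j : 'I_n) (r : R) : i != j ->
      elem_reach (transvection i j r *m A) B -> elem_reach A B
  | er_col A B (i j : 'I_n) (r : R) : i != j ->
      elem_reach (A *m transvection i j r) B -> elem_reach A B.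

(* Main.v *)
(* Let V(R) be the monoid of isomorphism classes of finitely generated projective
   modules, with [u] the class of R.  As R is exchange, so are its matrix rings,
   and V(R) has the refinement property; as R is separative, [a + c = b + c]
   implies [a = b] in V(R) as soon as [c] lies below multiples of [a] and of [b].

   If A is regular, then im A is isomorphic to a complement of ker A and to a
   complement of coker A.  Refining [i + k = i + c = n u] and moving pieces between
   summands makes the cancellation rule applicable and splits off a copy of R, so
   that A = P * diag(a, A') * Q with P and Q invertible.

   An invertible P has a first row defining a split surjection R + R^(n-1) -> R.
   The exchange property splits this R as [g1 + g'], with [g1] lifting to the
   summand R and [g'] to R^(n-1), with complements [h1] and [h'].  Interchanging a
   common part of [g1] and [h'] is an elementary operation, and can be chosen so
   that separativity then gives [h1 = g'];  interchanging these turns the first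
   entry into a unit, after which the row and column can be cleared. *)
From mathcomp Require Import boolp.
Require Import Defs.
From HB Require Import structures.
From mathcomp Require Import all_boot all_order all_algebra.
Set Implicit Arguments.
Unset Strict Implicit.
Unset Printing Implicit Defensive.
Import GRing.Theory.
Local Open Scope ring_scope.

(** * Separative refinement monoids *)

(** Equality of sums up to reordering. The padding by 0 gives every summand, the last one included,
    the shape [x + _]. *)
Ltac addr_ac :=
  rewrite -[LHS]addr0 -[RHS]addr0 -!addrA;
  repeat first
    [ reflexivity
    | match goal with
      | |- @GRing.add _ ?x _ = @GRing.add _ ?x _ => congr (_ + _)
      | |- @GRing.add _ ?x _ = _ => rewrite [in RHS](addrCA _ x)
      end ].

Section SeparativeRefinementMonoid.
Variable V : nmodType.
Implicit Types a b c d x y : V.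

Definition addle a b := exists z, b = a + z.

Definition refinement_monoid := forall a b c d, a + b = c + d ->
  exists r : V * V * V * V, let: (p, q, s, t) := r in
  [/\ a = p + q, b = s + t, c = p + s & d = q + t].

Definition separative_monoid :=
  forall a b, a + a = a + b -> a + b = b + b -> a = b.

Lemma addle_trans a b c : addle a b -> addle b c -> addle a c.
Proof. by move=> [z ->] [t ->]; exists (z + t); rewrite addrA. Qed.

Lemma addle_add a b c d : addle a b -> addle c d -> addle (a + c) (b + d).
Proof. by move=> [z ->] [t ->]; exists (z + t); rewrite addrACA. Qed.

Lemma addle_addl a b : addle a (a + b). Proof. by exists b. Qed.

Lemma addle_mulrn n a b : addle a b -> addle (a *+ n) (b *+ n).
Proof. by move=> [z ->]; exists (z *+ n); rewrite mulrnDl. Qed.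

Section Separative.
Hypothesis sepV : separative_monoid.

(** Descent on the number of copies: separativity applied to [a *+ k.+2] and [a *+ k.+1 + b] removes
    one [a] from each side, until the defining case of two copies is reached. *)
Lemma separative_mulrn n a b :
  a *+ n.+2 = a *+ n.+1 + b -> b *+ n.+2 = b *+ n.+1 + a -> a = b.
Proof.
have step k a0 b0 : a0 *+ k.+3 = a0 *+ k.+2 + b0 -> a0 *+ k.+2 = a0 *+ k.+1 + b0.
  move=> E; have absorb j : a0 *+ (k.+2 + j) + b0 = a0 *+ (k.+3 + j).
    by rewrite addnC [in RHS]addnC !mulrnDr -addrA -E.
  apply: sepV.
    rewrite -mulrnDr addrA -mulrnDr.
    by rewrite absorb; congr (_ *+ _); rewrite !addSn !addnS.
  rewrite addrA -mulrnDr absorb addrACA -mulrnDr.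
  rewrite (_ : (k.+1 + k.+1 = k.+2 + k)%N); last by rewrite !addSn !addnS.
  rewrite addrA absorb (_ : (k.+3 + k = k.+2 + k.+1)%N); last by rewrite !addSn !addnS.
  by rewrite absorb.
elim: n => [|n IHn] Ea Eb; last by apply: IHn; apply: step.
by apply: sepV; [exact: Ea | rewrite addrC -[RHS]mulr2n Eb].
Qed.

(** Writing [a *+ n.+1 = c + z] turns one further [a] into [b] by way of [a + c = b + c], and
    symmetrically for [b]; this is the situation of [separative_mulrn]. *)
Lemma separative_cancel n a b c :
  addle c (a *+ n) -> addle c (b *+ n) -> a + c = b + c -> a = b.
Proof.
move=> ca cb E; apply: (@separative_mulrn n).
  have [z Dz] : addle c (a *+ n.+1).
    by apply: addle_trans ca _; rewrite mulrSr; apply: addle_addl.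
  by rewrite mulrS Dz addrA E; addr_ac.
have [z Dz] : addle c (b *+ n.+1).
  by apply: addle_trans cb _; rewrite mulrSr; apply: addle_addl.
by rewrite mulrS Dz addrA -E; addr_ac.
Qed.
End Separative.

Section Refinement.
Hypothesis refV : refinement_monoid.

Lemma refinement a b c d : a + b = c + d ->
  exists p q s t, [/\ a = p + q, b = s + t, c = p + s & d = q + t].
Proof. by case/refV=> [[[[p q] s] t] H]; exists p, q, s, t. Qed.

(** Refinement cuts [y] into [n] pieces below [b]; [z] acts as an upper bound of these pieces that
    still lies below both [b] and [y]. *)
Lemma addle_mulrn_core n y b : addle y (b *+ n) ->
  exists z, [/\ addle z b, addle z y & addle y (z *+ n)].
Proof.
elim: n y => [|n IHn] y [r]; rewrite ?mulr0n ?mulrSr.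
  by move=> E; exists 0; split; [exists b | exists y | exists r]; rewrite ?add0r // mulr0n.
case/esym/refinement=> y1 [y2 [r1 [r2 [-> _ Db Dy2]]]].
have [z1 [[b' Db'] [y' ->] y1z]] : exists z, [/\ addle z b, addle z y1 & addle y1 (z *+ n)].
  by apply: IHn; rewrite Db; apply: addle_addl.
have := Dy2; rewrite Db'; case/refinement=> p [q [s [t [Dz1 -> Dy Dr]]]].
(* Only the part [s] of the last piece [y2 = p + s] that is not already below [z1] is added. *)
exists (z1 + s); split.
- by exists t; rewrite addrA.
- by exists (y' + p); rewrite Dy; addr_ac.
- rewrite mulrSr; apply: addle_add.
    by apply: addle_trans y1z _; apply: addle_mulrn; apply: addle_addl.
  by exists q; rewrite Dy Dz1; addr_ac.
Qed.
End Refinement.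

(** * Decompositions in a separative refinement monoid *)

Section SeparativeRefinement.
Hypotheses (sepV : separative_monoid) (refV : refinement_monoid).

(* Moving the common part [x] of [g1] and [h'] leaves [s], which is small enough
   (below [h1 + x] and [g' + x]) to be cancelled in
   [s + (h1 + x) = u = s + (g' + x)]. *)
Lemma separative_exchange m u g1 g' h1 h' :
  g1 + h1 = u -> g' + h' = u *+ m.+1 -> g1 + g' = u -> h1 + h' = u *+ m.+1 ->
  exists x s h'', [/\ g1 = x + s, h' = x + h'' & h1 + x = g' + x].
Proof.
move=> Eh1 Eg' Eg Eh.
have : g1 + (h1 + u *+ m) = h' + h1 by rewrite addrA Eh1 -mulrS -Eh addrC.
(* A first common part [x1] of [g1] and [h'], chosen so that the rest [s1] of [g1] lies below
   [h1]. *)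
case/(refinement refV)=> x1 [s1 [r1 [r2 [Dg1 _ Dh' Dh1]]]].
have : s1 + ((g' + x1) + u *+ m) = r1 + (g' + x1).
  transitivity (u *+ m.+1); first by rewrite mulrS -Eg Dg1; addr_ac.
  by rewrite -Eg' Dh'; addr_ac.
(* The common part grows by [x2], so that the new rest [s] also lies below [g' + x1]. *)
case/(refinement refV)=> x2 [s [r3 [r4 [Ds1 _ Dr1 Dg'x]]]].
exists (x1 + x2), s, r3; split.
- by rewrite Dg1 Ds1 addrA.
- by rewrite Dh' Dr1 addrA.
apply: (@separative_cancel sepV 1 _ _ s).
- by exists (x2 + r2 + (x1 + x2)); rewrite mulr1n Dh1 Ds1; addr_ac.
- by exists (r4 + x2); rewrite mulr1n [LHS]addrA Dg'x; addr_ac.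
transitivity u; first by rewrite -Eh1 Dg1 Ds1; addr_ac.
by rewrite -Eg Dg1 Ds1; addr_ac.
Qed.

(** To be read with [i], [k], [c] the classes of image, kernel and cokernel of a regular matrix:
    source and target split compatibly into a part of class [u] and one of class [u *+ m]. *)
Lemma separative_diagonal m u i k c :
  i + k = u + u *+ m -> i + c = u + u *+ m ->
  exists i1 i' k1 k' c1 c', [/\ i = i1 + i', k = k1 + k', c = c1 + c'
    & [/\ i1 + k1 = u, i1 + c1 = u, i' + k' = u *+ m & i' + c' = u *+ m]].
Proof.
move=> Eik Eic.
have [i1 [i' [k1 [k' [Di Dk Eu Em i'le]]]]] : exists i1 i' k1 k', 
    [/\ i = i1 + i', k = k1 + k', u = i1 + k1, u *+ m = i' + k'
      & addle i' (i1 *+ m)].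
  have [i1 [i' [k1 [k' [-> -> Eu Em]]]]] := refinement refV Eik.
  have := Em; rewrite {1}Eu mulrnDl.
  case/(refinement refV)=> y [q [x [t [Di1 Dk1 Di' _]]]].
  have [z [[k1r Dk1r] [xr Dxr] xz]] :
      exists z, [/\ addle z k1, addle z x & addle x (z *+ m)].
    by apply: (addle_mulrn_core refV); rewrite Dk1; apply: addle_addl.
  (* Trading [z] between [k1] and [i'] keeps both sums and makes [i'] small: [y] is below [i1 *+ m],
     and [xr] is below [z *+ m]. *)
  exists (i1 + z), (y + xr), k1r, (k' + z); split.
  - by rewrite Di' Dxr; addr_ac.
  - by rewrite Dk1r; addr_ac.
  - by rewrite Eu Dk1r; addr_ac.
  - by rewrite Em Di' Dxr; addr_ac.
  rewrite mulrnDl; apply: addle_add; first by exists q.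
  by apply: addle_trans xz; exists z; rewrite Dxr addrC.
(* The bound on [i'] allows it to be cancelled from [i + k = i + c]. *)
have Ei1 : i1 + k = i1 + c.
  apply: (@separative_cancel sepV m _ _ i').
  - by apply: addle_trans i'le _; apply/addle_mulrn/addle_addl.
  - by apply: addle_trans i'le _; apply/addle_mulrn/addle_addl.
  have := Eik; rewrite -Eic Di => E.
  by rewrite addrAC E addrAC.
(* Refining twice shows that [k] and [c] differ only by pieces [a] and [b] that are interchangeable
   next to a part [w] of [i1]. *)
have [w [a [b [d [Di1 Dk' Dc Ew]]]]] : exists w a b d,
    [/\ i1 = w + a, k = d + a, c = d + b & w + a = w + b].
  have [e [b0 [a0 [d [D1 Dk' D2 Dc]]]]] := refinement refV Ei1.
  have : e + b0 = e + a0 by rewrite -D1.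
  case/(refinement refV)=> e2 [a2 [b2 [d2 [D3 D4 D5 D6]]]].
  exists (e2 + b2 + d2), a2, b2, (d + d2); split.
  - by rewrite D1 D3 D4; addr_ac.
  - by rewrite Dk' D6; addr_ac.
  - by rewrite Dc D4; addr_ac.
  - by rewrite -D5 {1}D5 D3; addr_ac.
have := Dk; rewrite Dk'; case/(refinement refV)=> d1 [d' [a1 [a' [Dd Da Dk1 Dk'']]]].
(* The part [a'] of [k'] is exchanged with the copy of [a'] inside [i1]. All of [a] then sits in the
   first summand, together with [w], where it can be replaced by [b]. *)
exists (w + a1), (i' + a'), (d1 + a), d', (d1 + b), d'; split.
- by rewrite Di Di1 Da; addr_ac.
- by rewrite Dd; addr_ac.
- by rewrite Dc Dd; addr_ac.
have E1 : w + a1 + (d1 + a) = u by rewrite Eu Di1 Dk1 Da; addr_ac.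
split=> //; last 2 first.
- by rewrite Em Dk''; addr_ac.
- by rewrite Em Dk''; addr_ac.
rewrite -E1; transitivity ((w + b) + (a1 + d1)); first by addr_ac.
by rewrite -Ew; addr_ac.
Qed.
End SeparativeRefinement.
End SeparativeRefinementMonoid.

(** * Exchange rings *)

(* The exchange property of the corner ring [e * S * e]; the last components
   record the usual normalization making [r] and [s] generalized inverses. *)
Definition exchange_corner (S : pzRingType) (e : S) :=
  forall a, e * a = a -> a * e = a -> exists r s,
  [/\ [/\ e * r = r, r * e = r, e * s = s & s * e = s],
      r * a * r = r, s * (e - a) * s = s & a * r + (e - a) * s = e].


(** Equality in an abelian group: everything is moved to one side, and each leading term is
    cancelled against its opposite. *)
Ltac zmod_ac :=
  apply/eqP; rewrite -subr_eq0 ?opprD ?opprK; apply/eqP;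
  rewrite -[LHS]addr0 -!addrA;
  repeat first
    [ reflexivity
    | rewrite addKr
    | rewrite addNKr
    | match goal with
      | |- @GRing.add _ (- ?x) _ = _ => rewrite (addrCA _ x)
      | |- @GRing.add _ ?x _ = _ => rewrite (addrCA _ (- x))
      end ].

Section ExchangeCorner.
Variable S : pzRingType.
Implicit Types a b e f g r s x y : S.

(** For [a] in the corner, the idempotent [g = a * r] satisfies [e * g = g], so [g * e] is an
    idempotent of the corner; multiplying [r] and [s] by the idempotents normalizes them. *)
Lemma exchange_ring_corner e :
  exchange_ring S -> e * e = e -> exchange_corner e.
Proof.
move=> exS ee a ea ae; have [g [gg [r Dg] [s Dg']]] := exS a.
have eg : e * g = g by rewrite Dg mulrA ea.
have Da : (e - a) * e = e - a by rewrite mulrBl ee ae.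
have Da' : e * (1 - a) = e - a by rewrite mulrBr mulr1 ea.
have ar : a * (e * r * g * e) = g * e by rewrite !mulrA ae -Dg gg.
have as_ : (e - a) * (e * s * (1 - g) * e) = e - g * e.
  rewrite !mulrA Da -Da' -(mulrA e) -Dg' [e * (1 - g)]mulrBr mulr1 eg.
  by rewrite [(e - g) * (1 - g)]mulrBr mulr1 mulrBl eg gg subrr subr0 mulrBl ee.
exists (e * r * g * e), (e * s * (1 - g) * e); split.
- by split; solve [rewrite !mulrA ee // | rewrite -!mulrA ee //].
- rewrite -mulrA ar -!mulrA; congr (_ * (_ * _)).
  by rewrite [e * (g * e)]mulrA eg mulrA gg.
- rewrite -mulrA as_ -!mulrA; congr (_ * (_ * _)).
  rewrite [e * (e - _)]mulrBr ee [e * (g * e)]mulrA eg.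
  rewrite -[X in _ * (X - _)]mul1r -mulrBl mulrA mulrBr mulr1.
  by rewrite [(1 - g) * g]mulrBl mul1r gg subrr subr0.
- by rewrite ar as_ addrC subrK.
Qed.

(* Write S = P + Q with P = e S and Q = (1 - e) S.  The exchange property of P
   splits a S and b S partially; that of Q is applied to the restriction to the
   remaining complements of the map to Q, sheared so as to vanish on P.
   The two choices together differ from a decomposition of 1 only by the
   base change U = (1 + d) (1 + c), a product of unitriangular matrices. *)
Lemma exchange_corner_ring e : e * e = e ->
  exchange_corner e -> exchange_corner (1 - e) -> exchange_ring S.
Proof.
move=> ee exe + a; have [f Df] : exists f, f = 1 - e by exists (1 - e).
have [b Db] : exists b, b = 1 - a by exists (1 - a).
rewrite -Df => exf.
have ef : e * f = 0 by rewrite Df mulrBr mulr1 ee subrr.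
have fe : f * e = 0 by rewrite Df mulrBl mul1r ee subrr.
have ff : f * f = f by rewrite {2}Df mulrBr mulr1 fe subr0.
have De : e - e * a * e = e * b * e by rewrite Db [e * (1 - a)]mulrBr mulr1 [RHS]mulrBl ee.
have [] := exe (e * a * e); first by rewrite !mulrA ee.
  by rewrite -mulrA ee.
move=> r [s [[er re es se]]]; rewrite De => rar sbs ars.
have {}rar : r * a * r = r by rewrite -[RHS]rar !mulrA re -(mulrA (r * a)) er.
have {}sbs : s * b * s = s by rewrite -[RHS]sbs !mulrA se -(mulrA (s * b)) es.
have {}ars : e * a * r + e * b * s = e.
  by rewrite -[RHS]ars -!mulrA er es.
have sar : s * a * r = 0.
  rewrite -{1}se -!mulrA [e * (a * r)]mulrA -[X in s * X](addrK (e * b * s)) ars.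
  by rewrite mulrBr se !mulrA se sbs subrr.
have rbs : r * b * s = 0.
  rewrite -{1}re -!mulrA [e * (b * s)]mulrA -[X in r * X](addKr (e * a * r)) ars.
  by rewrite mulrDr re mulrN !mulrA re rar addNr.
have rf : r * f = 0 by rewrite -re -mulrA ef mulr0.
have sf : s * f = 0 by rewrite -se -mulrA ef mulr0.
have [d Dd] : exists d, d = f * (a * r + b * s) by exists (f * (a * r + b * s)).
have ed : e * d = 0 by rewrite Dd mulrA ef mul0r.
have de : d * e = d by rewrite Dd -mulrA mulrDl -!mulrA re se.
have df : d * f = 0 by rewrite -[d]de -mulrA ef mulr0.
have fd : f * d = d by rewrite Dd mulrA ff.
have absum : a * r + b * s = e + d.
  by rewrite -[LHS]mul1r -(subrK e 1) mulrDl -Df -Dd mulrDr !mulrA ars addrC.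
(* [f - d] is the idempotent with the same image as [f] that kills [a * r] and [b * s]; [c0] and
   [f - c0] are the compressions of [a] and [b] by it. *)
pose c0 := (f - d) * a * f.
have fd_f : (f - d) * f = f by rewrite mulrBl ff df subr0.
have Dc0 : f - c0 = (f - d) * b * f.
  by rewrite /c0 Db [(f - d) * (1 - a)]mulrBr mulr1 [RHS]mulrBl fd_f.
have [] := exf c0.
- by rewrite /c0 !mulrA mulrBr ff fd.
- by rewrite /c0 -mulrA ff.
move=> r' [s' []]; rewrite Dc0 => -[fr rf' fs sf'] rcr scs crs.
set h := c0 * r' in crs; set g := e * a * r.
have sc0r : s' * h = 0.
  rewrite -[h](addrK ((f - d) * b * f * s')) crs mulrBr sf'.
  by rewrite !mulrA in scs *; rewrite scs subrr.
have r'h : r' * h = r' by rewrite /h mulrA.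
have re' : r' * e = 0 by rewrite -rf' -mulrA fe mulr0.
have se' : s' * e = 0 by rewrite -sf' -mulrA fe mulr0.
(* The corrections give [r * a * r1 = 0] and [s * b * s1 = 0]: the second choice is moved into the
   complements left by the first. *)
have [r1 Dr1] : exists r1, r1 = r' - r * a * r' by exists (r' - r * a * r').
have [s1 Ds1] : exists s1, s1 = s' - s * b * s' by exists (s' - s * b * s').
have dar : d * a * r = f * a * r.
  rewrite -[d in LHS]de Dd mulrDr !mulrDl -!mulrA (mulrA r e) re (mulrA s e) se.
  by rewrite (mulrA s a r) sar !mulr0 addr0 (mulrA r a r) rar.
have dbs : d * b * s = f * b * s.
  rewrite -[d in LHS]de Dd mulrDr !mulrDl -!mulrA (mulrA r e) re (mulrA s e) se.
  by rewrite (mulrA r b s) rbs !mulr0 add0r (mulrA s b s) sbs.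
have [t Dt'] : exists t, t = a * r1 + b * s1 by exists (a * r1 + b * s1).
have [c Dc] : exists c, c = e * t by exists (e * t).
have Dt : t = (a * r' + b * s') - (a * r * a * r' + b * s * b * s').
  by rewrite Dt' Dr1 Ds1 !mulrBr !mulrA; zmod_ac.
have ft : f * t = f + d * c.
  have -> : d * c = d * t by rewrite Dc mulrA de.
  have : (f - d) * t = f; last by rewrite mulrBl => {2}<-; rewrite subrK.
  have Z1 : (f - d) * a * r = 0 by rewrite !mulrBl dar subrr.
  have Z2 : (f - d) * b * s = 0 by rewrite !mulrBl dbs subrr.
  rewrite Dt mulrBr !mulrDr !mulrA Z1 Z2 !mul0r addr0 subr0.
  by rewrite -[in RHS]crs /h /c0 -!mulrA fr fs.
have absum1 : a * (r + r1) + b * (s + s1) = (1 + d) * (1 + c).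
  have Et : t = f + d * c + c.
    by rewrite -[LHS]mul1r -(subrK e 1) -Df mulrDl ft -Dc.
  rewrite (mulrDr a) (mulrDr b) addrACA absum -Dt' Et Df.
  by rewrite mulrDr mulr1 mulrDl mul1r; zmod_ac.
have r't : t * e = 0.
  by rewrite Dt' Dr1 Ds1 mulrDl -!mulrA !mulrBl -!mulrA re' se' !mulr0 subrr !mulr0 addr0.
have cc : c * c = 0 by rewrite Dc mulrA -(mulrA e t e) r't mulr0 mul0r.
have dd : d * d = 0 by rewrite -{1}[d]de -mulrA ed mulr0.
have inv1 z : z * z = 0 -> (1 + z) * (1 - z) = 1.
  by move=> zz; rewrite mulrBr mulr1 mulrDl mul1r zz addr0 addrK.
have inv2 z : z * z = 0 -> (1 - z) * (1 + z) = 1.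
  by move=> zz; rewrite mulrDr mulr1 mulrBl mul1r zz subr0 subrK.
pose U := (1 + d) * (1 + c); pose W := (1 - c) * (1 - d).
have UW : U * W = 1 by rewrite /U /W mulrA -(mulrA _ (1 + c)) inv1 // mulr1 inv1.
have WU : W * U = 1 by rewrite /U /W mulrA -(mulrA _ (1 - d)) inv2 // mulr1 inv2.
rewrite -/U in absum1; move: U W UW WU absum1 => U W UW WU absum1.
(* [eps] selects the first summand of [U], as [U * eps = a * (r + r1)]. Hence [U * eps * W] is the
   required idempotent, with complement [b * (s + s1) * W]. *)
pose eps := g + h.
have rh : r * h = 0
  by rewrite /h /c0 !mulrA mulrBr rf -fd mulrA rf mul0r subr0 !mul0r.
have r_eps : (r + r1) * eps = r + r1.
  have E1 : r * g = r by rewrite /g !mulrA re.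
  have E3 : r1 * g = 0.
    by rewrite /g Dr1 mulrBl -!mulrA !(mulrA r' e) re' !(mul0r, mulr0) subrr.
  have E4 : r1 * h = r1 by rewrite Dr1 mulrBl -(mulrA (r * a)) r'h.
  by rewrite mulrDl !mulrDr E1 rh E3 E4 addr0 add0r.
have s_eps : (s + s1) * eps = 0.
  have E1 : s * g = 0 by rewrite /g !mulrA se.
  have E2 : s * h = 0 by rewrite /h /c0 !mulrA mulrBr sf -fd mulrA sf mul0r subr0 !mul0r.
  have E3 : s1 * g = 0.
    by rewrite /g Ds1 mulrBl -!mulrA !(mulrA s' e) se' !(mul0r, mulr0) subrr.
  have E4 : s1 * h = 0 by rewrite Ds1 mulrBl -(mulrA (s * b)) sc0r mulr0 subrr.
  by rewrite mulrDl !mulrDr E1 E2 E3 E4 !addr0.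
have eps_idem : eps * eps = eps.
  have he : h * e = 0 by rewrite /h -mulrA re' mulr0.
  have gh : g * h = 0 by rewrite /g -mulrA rh mulr0.
  have hg : h * g = 0 by rewrite /g !mulrA he !mul0r.
  have gg : g * g = g by rewrite /g !mulrA -(mulrA _ r e) re -!mulrA (mulrA r a r) rar.
  have hh : h * h = h by rewrite {1}/h -mulrA r'h.
  by rewrite mulrDl !mulrDr gg gh hg hh addr0 add0r.
have Ueps : U * eps = a * (r + r1).
  by rewrite -absum1 mulrDl -!mulrA r_eps s_eps mulr0 addr0.
exists (a * ((r + r1) * W)); split.
- rewrite [a * _]mulrA -Ueps -!mulrA (mulrA W).
  by rewrite WU mul1r (mulrA eps eps) eps_idem.
- by exists ((r + r1) * W).
exists ((s + s1) * W).
by rewrite -Db -{1}UW -absum1 mulrDl !mulrA addrC addKr.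
Qed.
End ExchangeCorner.

(** * Matrix rings over an exchange ring *)

Section ExchangeMatrix.
Variable R : pzRingType.

Lemma exchange_corner_ul m n : exchange_ring 'M[R]_m ->
  exchange_corner (block_mx 1%:M 0 0 0 : 'M[R]_(m + n)).
Proof.
move/exchange_ring_corner/(_ (mulr1 1)) => exM a; rewrite -[a]submxK.
move: (ulsubmx a) (ursubmx a) (dlsubmx a) (drsubmx a) => {a} a b c d.
rewrite -mulmxE !mulmx_block !(mul1mx, mul0mx, mulmx1, mulmx0, addr0).
case/eq_block_mx=> _ _ <- <- /eq_block_mx[_ <- _ _].
have [r [s [_ rar sas ars]]] := exM a (mul1r a) (mulr1 a).
rewrite opp_block_mx add_block_mx !oppr0 !addr0.
exists (block_mx r 0 0 0), (block_mx s 0 0 0); split.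
- by rewrite !mulmx_block !(mul1mx, mul0mx, mulmx1, mulmx0, addr0).
- by rewrite !mulmx_block !(mul1mx, mul0mx, mulmx1, mulmx0, addr0) !mulmxE rar.
- by rewrite !mulmx_block !(mul1mx, mul0mx, mulmx1, mulmx0, addr0) !mulmxE sas.
- rewrite !mulmx_block add_block_mx !(mul1mx, mul0mx, mulmx1, mulmx0, addr0).
  by rewrite !mulmxE ars.
Qed.

Lemma exchange_corner_dr m n : exchange_ring 'M[R]_n ->
  exchange_corner (block_mx 0 0 0 1%:M : 'M[R]_(m + n)).
Proof.
move/exchange_ring_corner/(_ (mulr1 1)) => exM a; rewrite -[a]submxK.
move: (ulsubmx a) (ursubmx a) (dlsubmx a) (drsubmx a) => {a} b c d a.
rewrite -mulmxE !mulmx_block !(mul1mx, mul0mx, mulmx1, mulmx0, addr0, add0r).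
case/eq_block_mx=> <- <- _ _ /eq_block_mx[_ _ <- _].
have [r [s [_ rar sas ars]]] := exM a (mul1r a) (mulr1 a).
rewrite opp_block_mx add_block_mx !oppr0 !addr0.
exists (block_mx 0 0 0 r), (block_mx 0 0 0 s); split.
- by rewrite !mulmx_block !(mul1mx, mul0mx, mulmx1, mulmx0, addr0, add0r).
- by rewrite !mulmx_block !(mul1mx, mul0mx, mulmx1, mulmx0, addr0, add0r) !mulmxE rar.
- by rewrite !mulmx_block !(mul1mx, mul0mx, mulmx1, mulmx0, addr0, add0r) !mulmxE sas.
- rewrite !mulmx_block add_block_mx !(mul1mx, mul0mx, mulmx1, mulmx0, addr0, add0r).
  by rewrite !mulmxE ars.
Qed.

(** Induction on the size: the identity is the sum of two diagonal block idempotents whose corners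
    are the matrix rings of sizes 1 and [n]. *)
Lemma exchange_ring_matrix n : exchange_ring R -> exchange_ring 'M[R]_n.
Proof.
move=> exR; elim: n => [|n IHn].
  move=> a; exists 0; split; first by rewrite mulr0.
    by exists 0; rewrite mulr0.
  by exists 0; apply/matrixP => -[].
have ex1 : exchange_ring 'M[R]_1.
  move=> a; have [e [ee [r De] [s De']]] := exR (a 0 0).
  rewrite [a]mx11_scalar; exists e%:M; split.
  - by rewrite -mulmxE -scalar_mxM ee.
  - by exists r%:M; rewrite -mulmxE -scalar_mxM De.
  - by exists s%:M; rewrite -[1]/(1%:M) -!raddfB -mulmxE -scalar_mxM De'.
apply: (@exchange_corner_ring _ (block_mx 1%:M 0 0 0 : 'M[R]_(1 + n))).
- by rewrite -mulmxE mulmx_block !(mul1mx, mul0mx, mulmx0, addr0).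
- exact: exchange_corner_ul.
rewrite [1](_ : _ = block_mx 1%:M 0 0 1%:M :> 'M[R]_(1 + n)); last exact: scalar_mx_block.
rewrite opp_block_mx add_block_mx subrr !oppr0 !addr0; exact: exchange_corner_dr.
Qed.
End ExchangeMatrix.

(** * The monoid V(R) *)

Section MvN.
Local Open Scope quotient_scope.
Variable R : pzRingType.

Definition mvn m n (e : 'M[R]_m) (f : 'M[R]_n) :=
  exists x : 'M_(m, n), exists y : 'M_(n, m), x *m y = e /\ y *m x = f.

Lemma mvn_sym m n (e : 'M[R]_m) (f : 'M[R]_n) : mvn e f -> mvn f e.
Proof. by move=> [x [y [? ?]]]; exists y, x. Qed.

Lemma mvn_trans m n p (f : 'M[R]_n) (e : 'M[R]_m) (g : 'M[R]_p) :
  e *m e = e -> g *m g = g -> mvn e f -> mvn f g -> mvn e g.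
Proof.
move=> ee gg [x [y [xy yx]]] [z [w [zw wz]]]; exists (x *m z), (w *m y).
split; first by rewrite mulmxA -(mulmxA x) zw -yx mulmxA xy -mulmxA xy ee.
by rewrite mulmxA -(mulmxA w) yx -zw mulmxA wz -mulmxA wz gg.
Qed.

Lemma mvn_block m n p q (e : 'M[R]_m) (f : 'M[R]_n) (e' : 'M[R]_p) (f' : 'M[R]_q) :
  mvn e f -> mvn e' f' -> mvn (block_mx e 0 0 e') (block_mx f 0 0 f').
Proof.
move=> [x [y [<- <-]]] [z [w [<- <-]]].
exists (block_mx x 0 0 z), (block_mx y 0 0 w).
by rewrite !mulmx_block !(mulmx0, mul0mx, addr0, add0r).
Qed.

Lemma mvn_orth n (e f : 'M[R]_n) : e *m e = e -> f *m f = f ->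
  e *m f = 0 -> f *m e = 0 -> mvn (e + f) (block_mx e 0 0 f).
Proof.
move=> ee ff ef fe; exists (row_mx e f), (col_mx e f).
by rewrite mul_row_col mul_col_row ee ff ef fe.
Qed.

(** The size is part of the data, so that one quotient covers the idempotents of all sizes. *)
Definition idempotent_mx :=
  {p : {n : nat & 'M[R]_n} | tagged p *m tagged p == tagged p}.

Definition mvn_rel (p q : idempotent_mx) := `[< mvn (tagged (val p)) (tagged (val q)) >].

Lemma mvn_rel_refl : reflexive mvn_rel.
Proof.
move=> p; apply/asboolP; exists (tagged (val p)), (tagged (val p)).
by rewrite (eqP (valP p)).
Qed.

Lemma mvn_rel_sym : symmetric mvn_rel.
Proof. by move=> p q; apply/asboolP/asboolP; apply: mvn_sym. Qed.

Lemma mvn_rel_trans : transitive mvn_rel.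
Proof.
move=> q p r /asboolP pq /asboolP qr; apply/asboolP.
by apply: (mvn_trans _ _ pq qr); apply/eqP; [exact: (valP p) | exact: (valP r)].
Qed.

Canonical mvn_equiv := EquivRel mvn_rel mvn_rel_refl mvn_rel_sym mvn_rel_trans.

(* V(R): a finitely generated projective module is represented by an idempotent
   matrix, and isomorphism becomes Murray-von Neumann equivalence [mvn]. *)
Definition Vmon := {eq_quot mvn_equiv}.
HB.instance Definition _ := Choice.on Vmon.

Lemma idempotent0 : (0 : 'M[R]_0) *m (0 : 'M[R]_0) == 0.
Proof. by rewrite mul0mx. Qed.

Definition mx_tag n (e : 'M[R]_n) : {n : nat & 'M[R]_n} := Tagged _ e.

Definition to_idempotent_mx n (e : 'M[R]_n) : idempotent_mx :=
  insubd (exist _ (mx_tag 0) idempotent0) (mx_tag e).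

(* Junk value: a matrix that is not idempotent has class 0. *)
Definition cls n (e : 'M[R]_n) : Vmon := \pi_Vmon (to_idempotent_mx e).

Lemma to_idempotent_mxK n (e : 'M[R]_n) :
  e *m e = e -> val (to_idempotent_mx e) = mx_tag e.
Proof. by move=> ee; apply/insubdK/eqP. Qed.

Lemma cls_repr p : \pi_Vmon p = cls (tagged (val p)).
Proof.
rewrite /cls; congr (\pi_Vmon _); apply: val_inj; rewrite to_idempotent_mxK.
  by case: (val p).
exact/eqP/(valP p).
Qed.

Lemma cls_eq m n (e : 'M[R]_m) (f : 'M[R]_n) : e *m e = e -> f *m f = f ->
  cls e = cls f <-> mvn e f.
Proof.
move=> /to_idempotent_mxK De /to_idempotent_mxK Df.
have -> : (cls e = cls f) = mvn_rel (to_idempotent_mx e) (to_idempotent_mx f).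
  by apply/propext; split=> [/eqP | H]; [|apply/eqP]; rewrite eqmodE.
by rewrite /mvn_rel De Df; split=> /asboolP.
Qed.

Lemma cls_surj (v : Vmon) : exists n, exists2 e : 'M[R]_n, e *m e = e & v = cls e.
Proof.
elim/quotW: v => p; exists (tag (val p)), (tagged (val p)).
  exact/eqP/(valP p).
exact: cls_repr.
Qed.

Lemma block_idem m n (e : 'M[R]_m) (f : 'M[R]_n) : e *m e = e -> f *m f = f ->
  block_mx e 0 0 f *m block_mx e 0 0 f = block_mx e 0 0 f.
Proof. by move=> ee ff; rewrite mulmx_block ee ff !(mulmx0, mul0mx, addr0, add0r). Qed.

Definition Vadd (v w : Vmon) : Vmon :=
  cls (block_mx (tagged (val (repr v))) 0 0 (tagged (val (repr w)))).

Lemma VaddE m n (e : 'M[R]_m) (f : 'M[R]_n) : e *m e = e -> f *m f = f ->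
  Vadd (cls e) (cls f) = cls (block_mx e 0 0 f).
Proof.
have idr (v : Vmon) : tagged (val (repr v)) *m tagged (val (repr v)) = tagged (val (repr v)).
  exact/eqP/(valP (repr v)).
move=> ee ff; apply/cls_eq; rewrite ?block_idem //.
by apply: mvn_block; apply/cls_eq; rewrite // -cls_repr reprK.
Qed.

Lemma VaddC : commutative Vadd.
Proof.
move=> v w; have [m [e ee ->]] := cls_surj v; have [n [f ff ->]] := cls_surj w.
rewrite !VaddE //; apply/cls_eq; try exact: block_idem.
exists (block_mx 0 e f 0), (block_mx 0 f e 0).
by rewrite !mulmx_block !(mulmx0, mul0mx, addr0, add0r) ee ff.
Qed.

Lemma VaddA : associative Vadd.
Proof.
move=> u v w; have [m [e ee ->]] := cls_surj u; have [n [f ff ->]] := cls_surj v.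
have [p [g gg ->]] := cls_surj w.
rewrite !VaddE ?block_idem //; apply/cls_eq; rewrite ?block_idem //.
exists (block_mx (row_mx e 0) 0 (col_mx (row_mx 0 f) 0) (col_mx 0 g)).
exists (block_mx (col_mx e 0) (row_mx (col_mx 0 f) 0) 0 (row_mx 0 g)).
by split; rewrite !mulmx_block;
  do 3!rewrite ?mul_row_col ?mul_mx_row ?mul_col_mx ?(mulmx0, mul0mx, addr0, add0r);
  rewrite ?add_col_mx ?add_row_mx ?ee ?ff ?gg ?(addr0, add0r) ?row_mx0 ?col_mx0
    ?(addr0, add0r) -block_mxEh.
Qed.

Lemma Vadd0 : left_id (cls (0 : 'M[R]_0)) Vadd.
Proof.
move=> v; have [n [e ee ->]] := cls_surj v.
rewrite VaddE ?mul0mx //; apply/cls_eq; rewrite ?block_idem ?mul0mx //.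
exists (col_mx 0 e), (row_mx 0 e).
by rewrite mul_row_col mul_col_row !(mulmx0, mul0mx) add0r ee.
Qed.

HB.instance Definition _ := GRing.isNmodule.Build Vmon VaddA VaddC Vadd0.
End MvN.

(** * Orthogonal idempotents and addition in V(R) *)

Section VmonTheory.
Variable R : pzRingType.

Lemma clsD m n (e : 'M[R]_m) (f : 'M[R]_n) : e *m e = e -> f *m f = f ->
  cls (block_mx e 0 0 f) = cls e + cls f.
Proof. by move=> ee ff; rewrite -VaddE. Qed.

Lemma cls0 n : cls (0 : 'M[R]_n) = 0.
Proof. by apply/cls_eq; rewrite ?mul0mx //; exists 0, 0; rewrite !mul0mx. Qed.

Definition orth_idem n (e f : 'M[R]_n) :=
  [/\ e *m e = e, f *m f = f, e *m f = 0 & f *m e = 0].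

Lemma orth_idemD n (e f : 'M[R]_n) :
  orth_idem e f -> (e + f) *m (e + f) = e + f.
Proof. by case=> ee ff ef fe; rewrite mulmxDl !mulmxDr ee ff ef fe addr0 add0r. Qed.

Lemma orth_idemB n (e f : 'M[R]_n) : e *m e = e -> f *m f = f ->
  e *m f = f -> f *m e = f -> orth_idem f (e - f).
Proof.
move=> ee ff ef fe; split=> //; rewrite ?mulmxBl ?mulmxBr ?ee ?ff ?ef ?fe ?subrr ?subr0 //.
Qed.

Lemma cls_orth n (e f : 'M[R]_n) : orth_idem e f -> cls (e + f) = cls e + cls f.
Proof.
move=> H; case: (H) => ee ff ef fe; rewrite -clsD //; apply/cls_eq.
- exact: orth_idemD.
- exact: block_idem.
- exact: mvn_orth.
Qed.

Lemma cls_mx1 n : cls (1%:M : 'M[R]_n) = cls (1%:M : 'M[R]_1) *+ n.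
Proof.
elim: n => [|n IHn]; first by rewrite [1%:M]flatmx0 cls0.
rewrite mulrS -IHn -clsD ?mulmx1 //; congr cls.
exact: (@scalar_mx_block _ 1 n).
Qed.

(** Sums in V(R) lift to orthogonal decompositions: the two diagonal blocks are carried back to [e]
    along the equivalence given by [x] and [y]. *)
Lemma cls_split n (e : 'M[R]_n) v w : e *m e = e -> cls e = v + w ->
  exists e1 e2, [/\ orth_idem e1 e2, e = e1 + e2, cls e1 = v & cls e2 = w].
Proof.
have [p [f ff ->]] := cls_surj v; have [q [g gg ->]] := cls_surj w.
move=> ee; rewrite -clsD // => /(cls_eq ee (block_idem ff gg))[x [y [xy yx]]].
pose F := block_mx f 0 0 0 : 'M_(p + q); pose G := block_mx 0 0 0 g : 'M_(p + q).
have conj M N : x *m M *m y *m (x *m N *m y) = x *m (M *m (block_mx f 0 0 g) *m N) *m y.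
  by rewrite -yx !mulmxA.
have FG : orth_idem (x *m F *m y) (x *m G *m y).
  by split; rewrite conj !mulmx_block !(mulmx0, mul0mx, addr0, add0r) ?ff ?gg ?block_mx0
    ?mulmx0 ?mul0mx // /F /G ?ff ?gg.
case: (FG) => FF GG _ _.
exists (x *m F *m y), (x *m G *m y); split=> //.
- rewrite -mulmxDl -mulmxDr add_block_mx !addr0 add0r -yx.
  by rewrite !mulmxA xy -mulmxA xy ee.
- apply/cls_eq => //; exists (x *m col_mx f 0), (row_mx f 0 *m y); split.
    rewrite mulmxA -(mulmxA x) mul_col_mx mul_mx_row ff mulmx0 mul0mx.
    by rewrite /F block_mxEv row_mx0.
  rewrite mulmxA -(mulmxA _ y) yx mul_row_block mul_row_col.
  by rewrite !(mulmx0, mul0mx, addr0, add0r) !ff.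
- apply/cls_eq => //; exists (x *m col_mx 0 g), (row_mx 0 g *m y); split.
    rewrite mulmxA -(mulmxA x) mul_col_mx mul0mx mul_mx_row mulmx0 gg.
    by rewrite /G block_mxEv row_mx0.
  rewrite mulmxA -(mulmxA _ y) yx mul_row_block mul_row_col.
  by rewrite !(mulmx0, mul0mx, addr0, add0r) !gg.
Qed.
End VmonTheory.

(** The corner exchange property is applied to [e * f * e], whose complement in the corner is
    [e * f' * e]. Multiplying the resulting sum by [r] or [s] makes the mixed products vanish. *)
Lemma exchange_refine_idem (S : pzRingType) (e f f' : S) : exchange_ring S ->
  e * e = e -> e * (f + f') * e = e -> exists r s,
  [/\ [/\ e * r = r, r * e = r, e * s = s & s * e = s],
      [/\ r * f * r = r, s * f' * s = s, r * f' * s = 0 & s * f * r = 0]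
    & e * f * r + e * f' * s = e].
Proof.
move=> exS ee eff'; have De : e - e * f * e = e * f' * e.
  by rewrite -{1}eff' mulrDr mulrDl addrC addKr.
have [|| r [s [[er re es se]]]] := exchange_ring_corner exS ee (a := e * f * e).
- by rewrite !mulrA ee.
- by rewrite -mulrA ee.
rewrite De => rfr sf's efr.
have {}rfr : r * f * r = r by rewrite -[RHS]rfr !mulrA re -(mulrA (r * f)) er.
have {}sf's : s * f' * s = s by rewrite -[RHS]sf's !mulrA se -(mulrA (s * f')) es.
have {}efr : e * f * r + e * f' * s = e by rewrite -[RHS]efr -!mulrA er es.
exists r, s; split=> //; split=> //.
- rewrite -[r in LHS]re -!mulrA [e * (f' * s)]mulrA -[e * f' * s](addKr (e * f * r)) efr.
  by rewrite mulrDr re mulrN !mulrA re rfr addNr.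
- rewrite -[s in LHS]se -!mulrA [e * (f * r)]mulrA -[e * f * r](addrK (e * f' * s)) efr.
  by rewrite mulrBr se !mulrA se sf's subrr.
Qed.

(** Two decompositions [e1 + e2 = f1 + f2] of one idempotent are compared. The exchange property
    provides a copy of [e1] made of a summand of [f1] and a summand of [f2]; what remains of [f1]
    and [f2] is equivalent to [e2]. *)
Lemma Vmon_refinement (R : pzRingType) :
  exchange_ring R -> refinement_monoid (Vmon R).
Proof.
move=> exR a b c d Ecd; have [n [E EE DE]] := cls_surj (a + b).
have [e1 [e2 [[e11 e22 e12 e21] De <- <-]]] := cls_split EE (esym DE).
have [f1 [f2 [[f11 f22 f12 f21] Df <- <-]]] := cls_split EE (etrans (esym DE) Ecd).
have [|r [s [[er re es se] [rfr sfs rfs sfr] efe]]] :=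
  exchange_refine_idem (f := f1) (f' := f2) (@exchange_ring_matrix _ n exR) e11.
  by rewrite -Df De -mulmxE mulmxDr e11 e12 addr0 e11.
move: er re es se rfr sfs rfs sfr efe; rewrite -!mulmxE => er re es se rfr sfs rfs sfr efe.
have idr : (f1 *m r *m f1) *m (f1 *m r *m f1) = f1 *m r *m f1.
  by rewrite !mulmxA -(mulmxA _ f1 f1) f11 -(mulmxA f1 r) -(mulmxA f1 _ r) rfr mulmxA.
have ids : (f2 *m s *m f2) *m (f2 *m s *m f2) = f2 *m s *m f2.
  by rewrite !mulmxA -(mulmxA _ f2 f2) f22 -(mulmxA f2 s) -(mulmxA f2 _ s) sfs mulmxA.
have o1 : orth_idem (f1 *m r *m f1) (f1 - f1 *m r *m f1).
  by apply: orth_idemB; rewrite // -?mulmxA ?f11 // !mulmxA f11.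
have o2 : orth_idem (f2 *m s *m f2) (f2 - f2 *m s *m f2).
  by apply: orth_idemB; rewrite // -?mulmxA ?f22 // !mulmxA f22.
exists (cls (f1 *m r *m f1), cls (f2 *m s *m f2),
  cls (f1 - f1 *m r *m f1), cls (f2 - f2 *m s *m f2)); split; last 2 first.
- by rewrite -(cls_orth o1) addrC subrK.
- by rewrite -(cls_orth o2) addrC subrK.
- have o3 : orth_idem (e1 *m f1 *m r) (e1 *m f2 *m s).
    split.
    + by rewrite -!mulmxA [r *m _]mulmxA re [r *m _]mulmxA rfr.
    + by rewrite -!mulmxA [s *m _]mulmxA se [s *m _]mulmxA sfs.
    + by rewrite -!mulmxA [r *m _]mulmxA re [r *m _]mulmxA rfs !mulmx0.
    + by rewrite -!mulmxA [s *m _]mulmxA se [s *m _]mulmxA sfr !mulmx0.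
  case: (o3) => g1 g2 _ _; rewrite -{1}efe cls_orth //; congr (_ + _).
    apply/cls_eq => //; exists (e1 *m f1), (f1 *m r); split.
      by rewrite -(mulmxA e1) (mulmxA f1) f11 mulmxA.
    by rewrite -mulmxA (mulmxA r) re mulmxA.
  apply/cls_eq => //; exists (e1 *m f2), (f2 *m s); split.
    by rewrite -(mulmxA e1) (mulmxA f2) f22 mulmxA.
  by rewrite -mulmxA (mulmxA s) se mulmxA.
have o4 : orth_idem (f1 - f1 *m r *m f1) (f2 - f2 *m s *m f2).
  case: o1 => _ ? _ _; case: o2 => _ ? _ _; split=> //.
    by rewrite mulmxBl !mulmxBr -?mulmxA !(mulmxA f1 f2) f12 !(mul0mx, mulmx0) !subr0.
  by rewrite mulmxBl !mulmxBr -?mulmxA !(mulmxA f2 f1) f21 !(mul0mx, mulmx0) !subr0.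
rewrite -(cls_orth o4).
(* [P] links [e1] to [P']: it has the same kernel as [e1] and the same image as [P']. So the
   complements [A], [B] and [C] are equivalent in turn. *)
pose A := E - e1; pose P := f1 *m r + f2 *m s; pose B := E - P.
pose P' := f1 *m r *m f1 + f2 *m s *m f2; pose C := E - P'.
have DA : e2 = A by rewrite /A De addrC addKr.
have DC : f1 - f1 *m r *m f1 + (f2 - f2 *m s *m f2) = C.
  by rewrite /C /P' Df opprD addrACA.
rewrite DA DC.
have Ee : E *m e1 = e1 by rewrite De mulmxDl e11 e21 addr0.
have eE : e1 *m E = e1 by rewrite De mulmxDr e11 e12 addr0.
have Ef1 : E *m f1 = f1 by rewrite Df mulmxDl f11 f21 addr0.
have Ef2 : E *m f2 = f2 by rewrite Df mulmxDl f22 f12 add0r.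
have fE1 : f1 *m E = f1 by rewrite Df mulmxDr f11 f12 addr0.
have fE2 : f2 *m E = f2 by rewrite Df mulmxDr f22 f21 add0r.
have Pe : P *m e1 = P by rewrite mulmxDl -!mulmxA re se.
have eP : e1 *m P = e1 by rewrite mulmxDr !mulmxA.
have EP : E *m P = P by rewrite mulmxDr !mulmxA Ef1 Ef2.
have PE : P *m E = P by rewrite -Pe -mulmxA eE.
have EP' : E *m P' = P' by rewrite mulmxDr !mulmxA Ef1 Ef2.
have PE' : P' *m E = P' by rewrite mulmxDl -(mulmxA _ f1) -(mulmxA _ f2) fE1 fE2.
have rfrl (z : 'M_n) : z *m r *m f1 *m r = z *m r by rewrite -!(mulmxA z) rfr.
have sfsl (z : 'M_n) : z *m s *m f2 *m s = z *m s by rewrite -!(mulmxA z) sfs.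
have rfsl (z : 'M_n) : z *m r *m f2 *m s = 0 by rewrite -!(mulmxA z) rfs mulmx0.
have sfrl (z : 'M_n) : z *m s *m f1 *m r = 0 by rewrite -!(mulmxA z) sfr mulmx0.
have PP' : P *m P' = P'.
  by rewrite mulmxDl !mulmxDr !mulmxA rfrl rfsl sfrl sfsl !mul0mx addr0 add0r.
have P'P : P' *m P = P.
  rewrite mulmxDl !mulmxDr !mulmxA -![_ *m f1 *m f1]mulmxA -![_ *m f2 *m f2]mulmxA.
  rewrite -![_ *m f1 *m f2]mulmxA -![_ *m f2 *m f1]mulmxA f11 f22 f12 f21.
  by rewrite rfrl sfsl !mulmx0 !mul0mx addr0 add0r.
have AA : A *m A = A by rewrite /A mulmxBl !mulmxBr EE Ee eE e11 subrr subr0.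
have P'2 : P' *m P' = P' by rewrite -{2}PP' mulmxA P'P PP'.
have CC : C *m C = C by rewrite /C mulmxBl !mulmxBr EE EP' PE' P'2 subrr subr0.
have AB : mvn A B.
  by exists B, A; rewrite /A /B !mulmxBl !mulmxBr EE EP PE eP Pe Ee eE !subrr !subr0.
have BC : mvn B C.
  exists B, C; rewrite /C /B !mulmxBl !mulmxBr EE EP PE EP' PE' PP' P'P.
  by rewrite !opprB (addrA (E - P')) (addrA (E - P)) !subrK.
by apply/(cls_eq AA CC); apply: (mvn_trans AA CC AB BC).
Qed.

(** * Separativity of V(R) *)

Section Module.
Variables (S : pzRingType) (n : nat) (e : 'M[S]_n).

(** For idempotent [e] this is the image of right multiplication by [e], stated as a boolean
    condition so as to define a subtype. *)
Definition fixed_row : pred 'rV[S]_n := fun v => v *m e == v.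

Fact fixed_row_submod : GRing.submod_closed fixed_row.
Proof.
split=> [|a u v /eqP Du /eqP Dv]; rewrite /in_mem /= /fixed_row.
  by rewrite mul0mx.
by rewrite mulmxDl -scalemxAl Du Dv.
Qed.
HB.instance Definition _ := GRing.isSubmodClosed.Build _ _ _ fixed_row_submod.

Definition idem_module := {v | fixed_row v}.
HB.instance Definition _ := SubChoice.on idem_module.
HB.instance Definition _ := [SubChoice_isSubLmodule of idem_module by <:].

Hypothesis ee : e *m e = e.

Fact idem_module_proof (v : 'rV[S]_n) : fixed_row (v *m e).
Proof. by rewrite /fixed_row -mulmxA ee. Qed.

Definition to_idem_module (v : 'rV[S]_n) : idem_module :=
  exist _ (v *m e) (idem_module_proof v).

Lemma to_idem_module_linear : linear to_idem_module.
Proof. by move=> a u v; apply: val_inj; rewrite /= mulmxDl -scalemxAl. Qed.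

Lemma idem_moduleP (v : idem_module) : val v *m e = val v.
Proof. exact/eqP/(valP v). Qed.

Lemma val_linear : linear (val : idem_module -> 'rV[S]_n).
Proof. by []. Qed.
End Module.

(** * Isomorphism of modules and equivalence of idempotents *)

Section ModuleIso.
Variable R : pzRingType.

Lemma mod_iso_sym (M N : rmodType R) : mod_iso M N -> mod_iso N M.
Proof.
move=> [f [fl [g fK gK]]]; exists g; split; last by exists f.
by move=> a u v; rewrite -{1}[u]gK -{1}[v]gK -fl fK.
Qed.

Lemma mod_iso_trans (N M L : rmodType R) : mod_iso M N -> mod_iso N L -> mod_iso M L.
Proof.
move=> [f [fl fb]] [g [gl gb]]; exists (g \o f); split; last exact: bij_comp.
by move=> a u v; rewrite /= fl gl.
Qed.

Lemma idem_module_fg n (e : 'M[R^c]_n) : e *m e = e -> fg_projective (idem_module e).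
Proof.
move=> ee; exists n, (to_idem_module ee), val; split.
- exact: to_idem_module_linear.
- exact: val_linear.
- by move=> v; apply: val_inj; rewrite /= idem_moduleP.
Qed.

Lemma mvn_mod_iso m n (e : 'M[R^c]_m) (f : 'M[R^c]_n) :
  e *m e = e -> f *m f = f -> mvn e f -> mod_iso (idem_module e) (idem_module f).
Proof.
move=> ee ff [x [y [xy yx]]].
exists (fun v => to_idem_module ff (val v *m x)); split.
  by move=> a u v; apply: val_inj; rewrite /= !mulmxDl -!scalemxAl.
exists (fun v => to_idem_module ee (val v *m y)) => v; apply: val_inj => /=.
  by rewrite -yx !mulmxA -(mulmxA _ x y) xy -(mulmxA _ x y) xy !idem_moduleP.
by rewrite -xy !mulmxA -(mulmxA _ y x) yx -(mulmxA _ y x) yx !idem_moduleP.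
Qed.

(** Composed with the projection from the row space, a linear map between the modules is right
    multiplication by a matrix; for mutually inverse maps the two products are [e] and [f]. *)
Lemma mod_iso_mvn m n (e : 'M[R^c]_m) (f : 'M[R^c]_n) :
  e *m e = e -> f *m f = f -> mod_iso (idem_module e) (idem_module f) -> mvn e f.
Proof.
have mx p q (g : 'M[R^c]_p) (h : 'M[R^c]_q) (gg : g *m g = g)
    (phi : idem_module g -> idem_module h) :
    linear phi -> exists X, forall v, v *m X = val (phi (to_idem_module gg v)).
  move=> phil; pose F v := val (phi (to_idem_module gg v)).
  have Fl : linear F by move=> a u v; rewrite /F to_idem_module_linear phil.
  pose FL := GRing.isLinear.Build _ _ _ _ F Fl.
  pose Fc : {linear 'rV[R^c]_p -> 'rV[R^c]_q} := HB.pack F FL.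
  by exists (lin1_mx Fc) => v; rewrite mul_rV_lin1.
move=> ee ff [phi [phil [psi phiK psiK]]].
have psil : linear psi.
  by move=> a u v; rewrite -{1}[u]psiK -{1}[v]psiK -phil phiK.
have [X DX] := mx _ _ _ _ ee phi phil; have [Y DY] := mx _ _ _ _ ff psi psil.
have valK k (g : 'M[R^c]_k) (gg : g *m g = g) (v : idem_module g) :
  to_idem_module gg (val v) = v.
  by apply: val_inj; rewrite /= idem_moduleP.
exists X, Y; split; apply/row_matrixP => i; rewrite !rowE mulmxA.
  by rewrite DX DY valK phiK.
by rewrite DY DX valK psiK.
Qed.

Lemma idem_module_prod m n (e : 'M[R^c]_m) (f : 'M[R^c]_n) :
  mod_iso (idem_module e * idem_module f)%type (idem_module (block_mx e 0 0 f)).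
Proof.
have P (v : idem_module e * idem_module f) :
  fixed_row (block_mx e 0 0 f) (row_mx (val v.1) (val v.2)).
  by rewrite /fixed_row mul_row_block !mulmx0 addr0 add0r !idem_moduleP.
have Q (v : idem_module (block_mx e 0 0 f)) :
  fixed_row e (lsubmx (val v)) /\ fixed_row f (rsubmx (val v)).
  have := idem_moduleP v; rewrite -[val v]hsubmxK mul_row_block !mulmx0 addr0 add0r.
  by case/eq_row_mx=> H1 H2; rewrite /fixed_row !(row_mxKl, row_mxKr) H1 H2.
exists (fun v => exist (fixed_row (block_mx e 0 0 f)) _ (P v)); split.
  by move=> a u v; apply: val_inj; rewrite /= scale_row_mx add_row_mx.
exists (fun v => (exist (fixed_row e) _ (proj1 (Q v)), exist (fixed_row f) _ (proj2 (Q v)))).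
  by case=> u v; congr pair; apply: val_inj; rewrite /= ?row_mxKl ?row_mxKr.
by move=> v; apply: val_inj; rewrite /= hsubmxK.
Qed.

(** Transposition reverses products between [R] and [R^c]; it connects V(R) to right modules, which
    are row spaces over [R^c]. *)
Lemma mvn_tr m n (e : 'M[R]_m) (f : 'M[R]_n) :
  mvn e f -> mvn (e^T : 'M[R^c]_m) (f^T : 'M[R^c]_n).
Proof.
move=> [x [y [<- <-]]]; exists (y^T : 'M[R^c]_(m, n)), (x^T : 'M[R^c]_(n, m)).
by rewrite -!trmx_mul_rev.
Qed.

Lemma mvn_untr m n (e : 'M[R]_m) (f : 'M[R]_n) :
  mvn (e^T : 'M[R^c]_m) (f^T : 'M[R^c]_n) -> mvn e f.
Proof.
move=> [x [y [xy yx]]]; exists (y^T : 'M[R]_(m, n)), (x^T : 'M[R]_(n, m)).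
by split; apply: trmx_inj; rewrite trmx_mul_rev !trmxK ?xy ?yx.
Qed.
End ModuleIso.

Lemma Vmon_separative (R : pzRingType) : separative R -> separative_monoid (Vmon R).
Proof.
move=> sepR v w; have [m [e ee ->]] := cls_surj v; have [n [f ff ->]] := cls_surj w.
have ee' : (e^T : 'M[R^c]_m) *m e^T = e^T by rewrite -trmx_mul_rev ee.
have ff' : (f^T : 'M[R^c]_n) *m f^T = f^T by rewrite -trmx_mul_rev ff.
have tr k l (g : 'M[R]_k) (h : 'M[R]_l) :
  (block_mx g 0 0 h)^T = block_mx (g^T : 'M[R^c]_k) 0 0 (h^T : 'M[R^c]_l).
  by rewrite tr_block_mx !trmx0.
rewrite -!clsD // => /cls_eq H1 /cls_eq H2.
have {H1} := mvn_tr (H1 (block_idem ee ee) (block_idem ee ff)).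
have {H2} := mvn_tr (H2 (block_idem ee ff) (block_idem ff ff)).
rewrite !tr => /mvn_mod_iso H2 /mvn_mod_iso H1.
apply/cls_eq/mvn_untr/(mod_iso_mvn ee' ff') => //.
apply: sepR; try exact: idem_module_fg.
  apply: mod_iso_trans (idem_module_prod _ _) _.
  apply: mod_iso_trans (H1 _ _) _; rewrite ?block_idem //.
  exact/mod_iso_sym/idem_module_prod.
apply: mod_iso_trans (idem_module_prod _ _) _.
apply: mod_iso_trans (H2 _ _) _; rewrite ?block_idem //.
exact/mod_iso_sym/idem_module_prod.
Qed.

(** * Elementary matrices *)

Section Elementary.
Variable R : pzRingType.

Inductive elementary n : 'M[R]_n -> Prop :=
  | elementary1 : elementary 1%:M
  | elementaryS (i j : 'I_n) (r : R) (W : 'M[R]_n) : i != j ->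
      elementary W -> elementary (transvection i j r *m W).

Lemma elementary_transvection n (i j : 'I_n) (r : R) :
  i != j -> elementary (transvection i j r).
Proof.
move=> ij; rewrite -[transvection _ _ _]mulmx1.
by apply: elementaryS => //; constructor.
Qed.

Lemma elementary_mul n (V W : 'M[R]_n) :
  elementary V -> elementary W -> elementary (V *m W).
Proof.
move=> + eW; elim=> [|i j r U ij _ IH]; first by rewrite mul1mx.
by rewrite -mulmxA; apply: elementaryS.
Qed.

Lemma transvectionN n (i j : 'I_n) (r : R) : i != j ->
  transvection i j r *m transvection i j (- r) = 1%:M.
Proof.
move=> ij; rewrite /transvection scaleNr; set M := r *: delta_mx i j.
suff MM : M *m M = 0 by rewrite mulmxBr mulmx1 mulmxDl mul1mx MM addr0 addrK.
apply/matrixP=> k l; rewrite !mxE big1 // => h _.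
rewrite !mxE; case: (h =P j) => [->|_]; last by rewrite andbF mulr0 mul0r.
by rewrite [j == i]eq_sym (negPf ij) mulr0 mulr0.
Qed.

Lemma elementary_inv n (W : 'M[R]_n) : elementary W ->
  exists V, [/\ elementary V, W *m V = 1%:M & V *m W = 1%:M].
Proof.
elim=> [|i j r U ij _ [V [eV UV VU]]].
  by exists 1%:M; rewrite mul1mx; split=> //; constructor.
exists (V *m transvection i j (- r)); split.
- by apply: elementary_mul => //; apply: elementary_transvection.
- by rewrite mulmxA -(mulmxA _ U) UV mulmx1 transvectionN.
rewrite mulmxA -(mulmxA V) -[X in transvection i j (- r) *m transvection i j X]opprK.
by rewrite transvectionN // mulmx1.
Qed.

Lemma elem_reach_trans n (A B C : 'M[R]_n) :
  elem_reach A B -> elem_reach B C -> elem_reach A C.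
Proof.
elim=> [//|A' B' i j r ij _ IH /IH|A' B' i j r ij _ IH /IH] H.
  exact: er_row H.
exact: er_col H.
Qed.

Lemma elementary_row n (W A : 'M[R]_n) : elementary W -> elem_reach A (W *m A).
Proof.
elim=> [|i j r U ij _ IH]; first by rewrite mul1mx; constructor.
apply: elem_reach_trans IH _; rewrite -mulmxA; apply: er_row ij _; exact: er_refl.
Qed.

Lemma elementary_col n (W A : 'M[R]_n) : elementary W -> elem_reach A (A *m W).
Proof.
move=> eW; elim: eW A => [|i j r U ij _ IH] A; first by rewrite mulmx1; constructor.
by apply: er_col ij _; rewrite mulmxA; apply: IH.
Qed.

Lemma delta_mx_ur m n (i : 'I_m) (j : 'I_n) :
  delta_mx (lshift n i) (rshift m j) = block_mx 0 (delta_mx i j) 0 0 :> 'M[R]_(m + n).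
Proof.
apply/matrixP=> k l; rewrite -[k]splitK -[l]splitK.
case: (split k) (split l) => [k'|k'] [l'|l'] /=;
  rewrite ?block_mxEul ?block_mxEur ?block_mxEdl ?block_mxEdr !mxE
    ?eq_lshift ?eq_rshift ?eq_lrshift ?eq_rlshift ?andbF //.
Qed.

Lemma delta_mx_dl m n (i : 'I_m) (j : 'I_n) :
  delta_mx (rshift m j) (lshift n i) = block_mx 0 0 (delta_mx j i) 0 :> 'M[R]_(m + n).
Proof.
apply/matrixP=> k l; rewrite -[k]splitK -[l]splitK.
case: (split k) (split l) => [k'|k'] [l'|l'] /=;
  rewrite ?block_mxEul ?block_mxEur ?block_mxEdl ?block_mxEdr !mxE
    ?eq_lshift ?eq_rshift ?eq_lrshift ?eq_rlshift ?andbF //.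
Qed.

Lemma delta_mx_dr m n (i j : 'I_n) :
  delta_mx (rshift m i) (rshift m j) = block_mx 0 0 0 (delta_mx i j) :> 'M[R]_(m + n).
Proof.
apply/matrixP=> k l; rewrite -[k]splitK -[l]splitK.
case: (split k) (split l) => [k'|k'] [l'|l'] /=;
  rewrite ?block_mxEul ?block_mxEur ?block_mxEdl ?block_mxEdr !mxE
    ?eq_lshift ?eq_rshift ?eq_lrshift ?eq_rlshift ?andbF //.
Qed.

Lemma transvection_dr m n (i j : 'I_n) (r : R) :
  transvection (rshift m i) (rshift m j) r = block_mx 1%:M 0 0 (transvection i j r).
Proof.
rewrite /transvection delta_mx_dr scale_block_mx scalar_mx_block add_block_mx.
by rewrite !scaler0 !addr0.
Qed.

(** Addition of [b] corresponds to multiplication of these matrices, so multiples of matrix units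
    suffice, and these give transvections. *)
Lemma elementary_ur m n (b : 'M[R]_(m, n)) : elementary (block_mx 1%:M b 0 1%:M).
Proof.
rewrite (matrix_sum_delta b).
have E1 : elementary (block_mx 1%:M (0 : 'M[R]_(m, n)) 0 1%:M).
  by rewrite -scalar_mx_block; constructor.
have EM (c d : 'M[R]_(m, n)) : elementary (block_mx 1%:M c 0 1%:M) ->
    elementary (block_mx 1%:M d 0 1%:M) -> elementary (block_mx 1%:M (c + d) 0 1%:M).
  move=> ec ed; have := elementary_mul ec ed; rewrite mulmx_block.
  by rewrite !(mulmx0, mul0mx, mulmx1, mul1mx, addr0, add0r) addrC.
pose P (c : 'M[R]_(m, n)) := elementary (block_mx 1%:M c 0 1%:M).
apply: (@big_ind _ P) => // i _; apply: (@big_ind _ P) => // j _; rewrite /P.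
have -> : block_mx 1%:M (b i j *: delta_mx i j) 0 1%:M
    = transvection (lshift n i) (rshift m j) (b i j).
  rewrite /transvection delta_mx_ur scale_block_mx scalar_mx_block add_block_mx.
  by rewrite !scaler0 !addr0 add0r.
by apply: elementary_transvection; rewrite eq_lrshift.
Qed.

Lemma elementary_dl m n (c : 'M[R]_(n, m)) : elementary (block_mx 1%:M 0 c 1%:M).
Proof.
rewrite (matrix_sum_delta c).
have E1 : elementary (block_mx 1%:M 0 (0 : 'M[R]_(n, m)) 1%:M).
  by rewrite -scalar_mx_block; constructor.
have EM (b d : 'M[R]_(n, m)) : elementary (block_mx 1%:M 0 b 1%:M) ->
    elementary (block_mx 1%:M 0 d 1%:M) -> elementary (block_mx 1%:M 0 (b + d) 1%:M).
  move=> ec ed; have := elementary_mul ec ed; rewrite mulmx_block.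
  by rewrite !(mulmx0, mul0mx, mulmx1, mul1mx, addr0, add0r).
pose P (d : 'M[R]_(n, m)) := elementary (block_mx 1%:M 0 d 1%:M).
apply: (@big_ind _ P) => // i _; apply: (@big_ind _ P) => // j _; rewrite /P.
have -> : block_mx 1%:M 0 (c i j *: delta_mx i j) 1%:M
    = transvection (rshift m i) (lshift n j) (c i j).
  rewrite /transvection delta_mx_dl scale_block_mx scalar_mx_block add_block_mx.
  by rewrite !scaler0 !addr0 add0r.
by apply: elementary_transvection; rewrite eq_rlshift.
Qed.

Lemma elem_reach_dr m n (a : 'M[R]_m) (A B : 'M[R]_n) :
  elem_reach A B -> elem_reach (block_mx a 0 0 A) (block_mx a 0 0 B).
Proof.
elim=> [A'|A' B' i j r ij _ IH|A' B' i j r ij _ IH]; first exact: er_refl.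
  apply: (@er_row _ _ _ _ (rshift m i) (rshift m j) r); first by rewrite eq_rshift.
  by rewrite transvection_dr mulmx_block !(mulmx0, mul0mx, mul1mx, addr0, add0r).
apply: (@er_col _ _ _ _ (rshift m i) (rshift m j) r); first by rewrite eq_rshift.
by rewrite transvection_dr mulmx_block !(mulmx0, mul0mx, mulmx1, addr0, add0r).
Qed.
End Elementary.

(** * Diagonal reduction *)

Section UnimodularRow.
Variable R : pzRingType.

(** Cutting [x] and [y] down by the idempotents turns them into mutually inverse maps between the
    images of [e] and [f]. *)
Lemma mvn_norm m n (e : 'M[R]_m) (f : 'M[R]_n) :
  e *m e = e -> f *m f = f -> mvn e f -> exists x y,
  [/\ x *m y = e, y *m x = f & [/\ e *m x = x, x *m f = x, f *m y = y & y *m e = y]].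
Proof.
move=> ee ff [x [y [xy yx]]]; exists (e *m x), (f *m y).
have exf : e *m x *m f = e *m x by rewrite -yx !mulmxA -(mulmxA _ x y) xy ee.
have fye : f *m y *m e = f *m y by rewrite -xy !mulmxA -(mulmxA _ y x) yx ff.
split; [| |split=> //].
- by rewrite mulmxA exf -mulmxA xy ee.
- by rewrite mulmxA fye -mulmxA yx ff.
- by rewrite mulmxA ee.
- by rewrite mulmxA ff.
Qed.

Hypotheses (exR : exchange_ring R) (sepR : separative R).

(* In the proof [v = e2 *m a + p], where [p] is an isomorphism between the
   complements of the idempotents [x *m e2 *m a] and [e2]. *)
Lemma separative_row_unit m (a x e f : 'M[R]_1) (b : 'rV[R]_m.+1) (y : 'cV[R]_m.+1) :
  a *m x = e -> b *m y = f ->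
  e + f = 1%:M -> orth_idem e f -> e *m a = a -> f *m b = b ->
  x *m e = x -> y *m f = y ->
  cls (1%:M - x *m a) + cls (1%:M - y *m b) = cls (1%:M : 'M[R]_1) *+ m.+1 ->
  exists (t : 'rV[R]_m.+1) (c : 'cV[R]_m.+1) (w : 'M[R]_1),
  let v := a + (b + a *m t) *m c in v *m w = 1%:M /\ w *m v = 1%:M.
Proof.
move=> ax by_ ef1 oef ea fb xe yf hh.
have [ee ff ef fe] := oef.
have xax : x *m a *m (x *m a) = x *m a by rewrite mulmxA -(mulmxA x a x) ax xe.
have yby : y *m b *m (y *m b) = y *m b by rewrite mulmxA -(mulmxA y b y) by_ yf.
have o1x : orth_idem (x *m a) (1%:M - x *m a).
  by apply: orth_idemB; rewrite ?(mul1mx, mulmx1).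
have o1y : orth_idem (y *m b) (1%:M - y *m b).
  by apply: orth_idemB; rewrite ?(mul1mx, mulmx1).
have [_ h1i _ _] := o1x; have [_ h'i _ _] := o1y.
have g1E : cls e = cls (x *m a) by apply/cls_eq => //; exists a, x.
have g'E : cls f = cls (y *m b) by apply/cls_eq => //; exists b, y.
have [] := @separative_exchange _ (Vmon_separative sepR) (Vmon_refinement exR) m
  (cls (1%:M : 'M[R]_1)) (cls e) (cls f) (cls (1%:M - x *m a)) (cls (1%:M - y *m b)).
- by rewrite g1E -cls_orth // addrC subrK.
- by rewrite g'E -cls_orth // addrC subrK cls_mx1.
- by rewrite -cls_orth // ef1.
- exact: hh.
move=> X [s' [h'' [DeX DhX EX]]].
have [e1 [e2 [oe De De1 De2]]] := cls_split ee DeX.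
have [q1 [q2 [oq Dq Dq1 Dq2]]] := cls_split h'i DhX.
have [e11 e22 e12 e21] := oe; have [q11 q22 q12 q21] := oq.
(* [t] and [s] identify [e1] with a summand [q1] of the kernel of [b]. *)
have [|t [s [ts st [et tq qs se]]]] := @mvn_norm _ _ e1 q1 e11 q11.
  by apply/cls_eq; rewrite // De1 Dq1.
have ee1 : e *m e1 = e1 by rewrite De mulmxDl e11 e21 addr0.
have e1e : e1 *m e = e1 by rewrite De mulmxDr e11 e12 addr0.
have ee2 : e *m e2 = e2 by rewrite De mulmxDl e22 e12 add0r.
have e2e : e2 *m e = e2 by rewrite De mulmxDr e22 e21 add0r.
have fe1 : f *m e1 = 0 by rewrite -ee1 mulmxA fe mul0mx.
have e1f : e1 *m f = 0 by rewrite -e1e -mulmxA ef mulmx0.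
have yq : (1%:M - y *m b) *m q1 = q1 by rewrite Dq mulmxDl q11 q21 addr0.
have qy : q1 *m (1%:M - y *m b) = q1 by rewrite Dq mulmxDr q11 q12 addr0.
have bs : b *m s = 0.
  by rewrite -qs -yq !mulmxA mulmxBr mulmx1 mulmxA by_ fb subrr !mul0mx.
have ty : t *m y = 0.
  by rewrite -tq -qy -!mulmxA mulmxBl mul1mx -mulmxA by_ yf subrr !mulmx0.
(* Their classes are [cls f + X] and [cls (1%:M - x *m a) + X], which agree by the choice of [X]. *)
pose f2 := f + e1; pose Q := 1%:M - x *m e2 *m a.
have f2E : f2 = 1%:M - e2 by rewrite -ef1 De addrAC addrK addrC /f2.
have f2i : f2 *m f2 = f2 by apply: orth_idemD.
have axl k (M : 'M_(1, k)) : a *m (x *m M) = e *m M by rewrite mulmxA ax.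
have ox : orth_idem (1%:M - x *m a) (x *m e1 *m a).
  split=> //.
  - by rewrite -!mulmxA axl (mulmxA e) ee1 (mulmxA e1) e11.
  - by rewrite mulmxBl mul1mx -!mulmxA axl (mulmxA e) ee1 subrr.
  - by rewrite mulmxBr mulmx1 -!mulmxA axl ea subrr.
have DQ : Q = (1%:M - x *m a) + x *m e1 *m a.
  have Dxa : x *m a = x *m e1 *m a + x *m e2 *m a by rewrite -mulmxDl -mulmxDr -De xe.
  by rewrite /Q Dxa opprD addrA [RHS]addrAC subrK.
have Qi : Q *m Q = Q by rewrite DQ; apply: orth_idemD.
have [|p [q [pq qp [fp pQ Qq qf]]]] := @mvn_norm _ _ f2 Q f2i Qi.
  apply/cls_eq => //; rewrite DQ cls_orth // /f2 cls_orth // De1 -EX; congr (_ + _).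
  rewrite -De1; apply/cls_eq => //; first by case: ox.
  exists (e1 *m a), (x *m e1); split; last by rewrite -mulmxA (mulmxA e1) e11 mulmxA.
  by rewrite -mulmxA axl ee1 e11.
(* The first operation changes [b] into [b + t], with [(b + t) *m (y + s) = f2]. The second can
   therefore replace the part [e1 *m a] of [a] by [p]. *)
exists (x *m t), ((y + s) *m (p - e1 *m a)), (x *m e2 + q).
have -> : a + (b + a *m (x *m t)) *m ((y + s) *m (p - e1 *m a)) = e2 *m a + p.
  rewrite axl -[t in e *m t]et (mulmxA e) ee1 et.
  have bt : (b + t) *m (y + s) = f2.
    by rewrite mulmxDl !mulmxDr by_ bs ty ts addr0 add0r.
  rewrite (mulmxA (b + t)) bt.
  rewrite mulmxBr fp mulmxA [f2 *m e1]mulmxDl fe1 e11 add0r.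
  by rewrite -{1}ea De mulmxDl addrA addrAC (addrC (e1 *m a)) addrK.
have e2f2 : e2 *m f2 = 0 by rewrite f2E mulmxBr mulmx1 e22 subrr.
have f2e2 : f2 *m e2 = 0 by rewrite f2E mulmxBl mul1mx e22 subrr.
split; rewrite mulmxDl !mulmxDr.
  have -> : e2 *m a *m (x *m e2) = e2 by rewrite -mulmxA axl ee2 e22.
  have -> : e2 *m a *m q = 0.
    rewrite -Qq mulmxA mulmxBr mulmx1 !mulmxA -(mulmxA e2 a x) ax e2e e22.
    by rewrite subrr mul0mx.
  have -> : p *m (x *m e2) = 0.
    rewrite -pQ -mulmxA mulmxBl mul1mx -!mulmxA axl ee2 e22.
    by rewrite subrr mulmx0.
  by rewrite pq f2E addr0 add0r addrC subrK.
have -> : x *m e2 *m (e2 *m a) = x *m e2 *m a.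
  by rewrite -mulmxA (mulmxA e2) e22 mulmxA.
have -> : x *m e2 *m p = 0 by rewrite -fp -mulmxA (mulmxA e2) e2f2 mul0mx mulmx0.
have -> : q *m (e2 *m a) = 0 by rewrite -qf -mulmxA (mulmxA f2) f2e2 mul0mx mulmx0.
by rewrite qp /Q addr0 add0r addrC subrK.
Qed.


(* If [row_mx a b] is the first row of an invertible matrix, then its kernel
   is free; the left-hand side is the class of that kernel. *)
Lemma unimodular_kernel_cls m (P P' : 'M[R]_(1 + m)) (x : 'M[R]_1) (y : 'cV[R]_m) :
  let a := ulsubmx P in let b := ursubmx P in
  P *m P' = 1%:M -> P' *m P = 1%:M -> a *m x + b *m y = 1%:M ->
  x *m a *m x = x -> y *m b *m y = y -> x *m b *m y = 0 -> y *m a *m x = 0 ->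
  cls (1%:M - x *m a) + cls (1%:M - y *m b) = cls (1%:M : 'M[R]_1) *+ m.
Proof.
move=> a b PP' P'P axby xax yby xby yax.
have idx : (1%:M - x *m a) *m (1%:M - x *m a) = 1%:M - x *m a.
  by rewrite mulmxBl !mulmxBr !mulmx1 mul1mx !mulmxA xax subrr subr0.
have idy : (1%:M - y *m b) *m (1%:M - y *m b) = 1%:M - y *m b.
  by rewrite mulmxBl !mulmxBr !mulmx1 mul1mx !mulmxA yby subrr subr0.
rewrite -clsD // -cls_mx1; apply/cls_eq; rewrite ?block_idem ?mulmx1 //.
pose al := row_mx a b; pose Z := col_mx x y; pose Z0 := lsubmx P'.
pose N := rsubmx P'; pose B := dsubmx P.
have Dal : al = usubmx P by rewrite /al hsubmxK.
have /eq_block_mx[alZ0 _ _ BN] : block_mx (al *m Z0) (al *m N) (B *m Z0) (B *m N)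
    = block_mx 1%:M 0 0 1%:M.
  by rewrite -mul_col_row Dal vsubmxK hsubmxK PP' scalar_mx_block.
have ZN : Z0 *m al + N *m B = 1%:M by rewrite -mul_row_col Dal vsubmxK hsubmxK.
have alZ : al *m Z = 1%:M by rewrite mul_row_col.
(* Both idempotents project onto the kernel of [al], hence are equivalent; [E0 = N *m B] with
   [B *m N = 1%:M] shows that this kernel is free. *)
pose E1 := 1%:M - Z *m al; pose E0 := 1%:M - Z0 *m al.
have E10 : E1 *m E0 = E0.
  rewrite /E1 mulmxBl mul1mx /E0 mulmxBr mulmx1 -!mulmxA (mulmxA al Z0) alZ0.
  by rewrite mul1mx subrr subr0.
have E01 : E0 *m E1 = E1.
  rewrite /E0 mulmxBl mul1mx /E1 mulmxBr mulmx1 -!mulmxA (mulmxA al Z) alZ.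
  by rewrite mul1mx subrr subr0.
have E11 : E1 *m E1 = E1.
  rewrite {1}/E1 mulmxBl mul1mx /E1 mulmxBr mulmx1 -!mulmxA (mulmxA al Z) alZ.
  by rewrite mul1mx subrr subr0.
have E0N : E0 = N *m B by rewrite /E0 -ZN addrC addKr.
pose D := block_mx (x *m a) 0 0 (y *m b).
have -> : block_mx (1%:M - x *m a) 0 0 (1%:M - y *m b) = 1%:M - D.
  by rewrite scalar_mx_block opp_block_mx add_block_mx !oppr0 !addr0.
have ZalE : Z *m al = block_mx (x *m a) (x *m b) (y *m a) (y *m b) by rewrite mul_col_row.
have DZ : D *m (Z *m al) = Z *m al.
  by rewrite ZalE mulmx_block !(mul0mx, mulmx0, addr0, add0r) !mulmxA xax yby.
have ZD : Z *m al *m D = D.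
  rewrite ZalE mulmx_block !(mul0mx, mulmx0, addr0, add0r) !mulmxA.
  by rewrite xax yby xby yax !mul0mx.
have DD : (1%:M - D) *m (1%:M - D) = 1%:M - D.
  rewrite mulmxBl !mulmxBr !mulmx1 mul1mx mulmx_block.
  by rewrite !(mul0mx, mulmx0, addr0, add0r) !mulmxA xax yby subrr subr0.
(* [D] and [Z *m al] have the same image, so their complements [1%:M - D] and [E1] are
   equivalent. *)
apply: (@mvn_trans _ _ _ _ E1); rewrite ?mulmx1 //.
  exists (1%:M - D), E1; split.
    by rewrite /E1 mulmxBr !mulmxBl !mul1mx mulmx1 DZ subrr subr0.
  by rewrite /E1 mulmxBr !mulmxBl !mul1mx mulmx1 ZD subrr subr0.
apply: (@mvn_trans _ _ _ _ E0); rewrite ?mulmx1 //; first by exists E0, E1.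
by exists N, B.
Qed.

(** The first row of [P] times the first column of [P'] is 1; the exchange property refines this to
    a sum of complementary idempotents [e = a *m x] and [f = b *m y]. *)
Lemma separative_unimodular_row m (P P' : 'M[R]_(1 + m.+1)) :
  P *m P' = 1%:M -> P' *m P = 1%:M ->
  exists V v w, [/\ elementary V, usubmx (P *m V) = row_mx v 0,
     v *m w = 1%:M & w *m v = 1%:M].
Proof.
move=> PP' P'P; pose a := ulsubmx P; pose b := ursubmx P.
pose x0 := ulsubmx P'; pose y0 := dlsubmx P'.
have abxy : a *m x0 + b *m y0 = 1%:M.
  have := PP'; rewrite -{1}[P]submxK -{1}[P']submxK mulmx_block scalar_mx_block.
  by case/eq_block_mx.
have [||r [s []]] := exchange_ring_corner (@exchange_ring_matrix _ 1 exR) (mulr1 1)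
  (a := a *m x0); rewrite ?mul1r ?mulr1 //.
have -> : 1 - a *m x0 = b *m y0 by rewrite -[1]/(1%:M) -abxy addrC addKr.
rewrite -!mulmxE -[1]/(1%:M) => _ rar sbs rs.
pose e := a *m x0 *m r; pose f := b *m y0 *m s; pose x := x0 *m r; pose y := y0 *m s.
have ax : a *m x = e by rewrite mulmxA.
have by_ : b *m y = f by rewrite mulmxA.
have ee : e *m e = e by rewrite /e -!mulmxA -[in RHS]rar !mulmxA.
have De : f = 1%:M - e by rewrite -rs addrC addKr.
have oef : orth_idem e f.
  by rewrite De; apply: orth_idemB; rewrite ?mulmx1 ?mul1mx ?ee.
have [e2 f2 ef fe] := oef.
have xe : x *m e = x by rewrite /x -mulmxA -[r in RHS]rar !mulmxA.
have yf : y *m f = y by rewrite /y -mulmxA -[s in RHS]sbs !mulmxA.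
clearbody e f x y.
have xf : x *m f = 0 by rewrite -xe -mulmxA ef mulmx0.
have ye : y *m e = 0 by rewrite -yf -mulmxA fe mulmx0.
have [||||||||| t [c [w]]] := @separative_row_unit m (e *m a) x e f (f *m b) y.
- by rewrite -mulmxA ax ee.
- by rewrite -mulmxA by_ f2.
- by rewrite De addrC subrK.
- by [].
- by rewrite mulmxA ee.
- by rewrite mulmxA f2.
- by [].
- by [].
- rewrite !mulmxA xe yf.
  apply: unimodular_kernel_cls PP' P'P _ _ _ _ _; rewrite -?mulmxA ?ax ?by_ //.
  by rewrite De addrC subrK.
set b3 := f *m b + _; set v := e *m a + _ => -[vw wv].
(* The first two factors turn the row into [e *m a] and [f *m b], the next two make its first entry
   the unit [v], and the last one clears the rest. *)
pose V := block_mx 1%:M (- (x *m b)) 0 1%:M *m (block_mx 1%:M 0 (- (y *m a)) 1%:M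
  *m (block_mx 1%:M t 0 1%:M *m (block_mx 1%:M 0 c 1%:M
  *m block_mx 1%:M (- (w *m b3)) 0 1%:M))).
exists V, v, w; split=> //.
  by do 4?[apply: elementary_mul; first by [apply: elementary_ur | apply: elementary_dl]];
    apply: elementary_ur.
rewrite -mul_usub_mx -[usubmx P]hsubmxK -/a -/b.
have -> : lsubmx (usubmx P) = a by [].
have -> : rsubmx (usubmx P) = b by [].
have b1 : a *m - (x *m b) + b = f *m b.
  by rewrite mulmxN mulmxA ax De mulmxBl mul1mx addrC.
have a1 : a + f *m b *m - (y *m a) = e *m a.
  rewrite mulmxN mulmxA -(mulmxA f) by_ f2 De mulmxBl mul1mx.
  by rewrite opprB addrC subrK.
rewrite /V; do 4!rewrite mulmxA mul_row_block !(mulmx0, mulmx1, addr0, add0r) ?b1 ?a1.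
rewrite mul_row_block !(mulmx0, mulmx1, addr0, add0r).
by rewrite (addrC (e *m a *m t)) -/b3 -/v mulmxN mulmxA vw mul1mx addNr.
Qed.

Lemma separative_reduce_unit m (P P' : 'M[R]_(1 + m.+1)) :
  P *m P' = 1%:M -> P' *m P = 1%:M ->
  exists V v w D D', [/\ elementary V, P *m V = block_mx v 0 0 D,
     v *m w = 1%:M /\ w *m v = 1%:M & D *m D' = 1%:M /\ D' *m D = 1%:M].
Proof.
move=> PP' P'P; have [V [v [w [eV Dv vw wv]]]] := separative_unimodular_row PP' P'P.
have [U [_ VU UV]] := elementary_inv eV.
pose Y := P *m V; pose X := U *m P'.
have YX : Y *m X = 1%:M by rewrite /Y /X mulmxA -(mulmxA P) VU mulmx1.
have XY : X *m Y = 1%:M by rewrite /Y /X mulmxA -(mulmxA U) P'P mulmx1.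
pose c := dlsubmx Y; pose D := drsubmx Y.
have DY : Y = block_mx v 0 c D by rewrite -[LHS]vsubmxK Dv block_mxEv hsubmxK.
move: YX XY; rewrite -[X]submxK DY.
move: (ulsubmx X) (ursubmx X) (dlsubmx X) (drsubmx X) => x1 x2 x3 x4.
rewrite !mulmx_block scalar_mx_block !mul0mx !mulmx0 !addr0 !add0r.
case/eq_block_mx=> _ vx2 _ + /eq_block_mx[_ _ x3c x4D].
(* As [v] is a unit, the inverse is block triangular too, and [D] is invertible with inverse
   [x4]. *)
have -> : x2 = 0 by rewrite -[x2]mul1mx -wv -mulmxA vx2 mulmx0.
rewrite mulmx0 add0r => Dx4.
exists (V *m block_mx 1%:M 0 (- (x4 *m c)) 1%:M), v, w, D, x4; split=> //.
  exact/elementary_mul/elementary_dl.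
rewrite mulmxA -/Y DY mulmx_block !(mul0mx, mulmx0, mulmx1, addr0, add0r).
by rewrite mulmxN mulmxA Dx4 mul1mx subrr.
Qed.

Lemma orth_idem_block n (g g' j1 j2 k1 k2 : 'M[R]_n) :
  orth_idem g g' -> orth_idem j1 j2 -> orth_idem k1 k2 ->
  g = j1 + j2 -> g' = k1 + k2 ->
  [/\ orth_idem j1 k1, orth_idem j2 k2 & orth_idem (j1 + k1) (j2 + k2)].
Proof.
move=> [gg g'g' gg' g'g] [j11 j22 j12 j21] [k11 k22 k12 k21] Dg Dg'.
have z (x y : 'M[R]_n) : x *m g = x -> g' *m y = y -> x *m y = 0.
  by move=> <- <-; rewrite mulmxA -(mulmxA x) gg' mulmx0 mul0mx.
have z' (x y : 'M[R]_n) : x *m g' = x -> g *m y = y -> x *m y = 0.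
  by move=> <- <-; rewrite mulmxA -(mulmxA x) g'g mulmx0 mul0mx.
have jg1 : j1 *m g = j1 by rewrite Dg mulmxDr j11 j12 addr0.
have jg2 : j2 *m g = j2 by rewrite Dg mulmxDr j22 j21 add0r.
have gj1 : g *m j1 = j1 by rewrite Dg mulmxDl j11 j21 addr0.
have gj2 : g *m j2 = j2 by rewrite Dg mulmxDl j22 j12 add0r.
have kg1 : k1 *m g' = k1 by rewrite Dg' mulmxDr k11 k12 addr0.
have kg2 : k2 *m g' = k2 by rewrite Dg' mulmxDr k22 k21 add0r.
have gk1 : g' *m k1 = k1 by rewrite Dg' mulmxDl k11 k21 addr0.
have gk2 : g' *m k2 = k2 by rewrite Dg' mulmxDl k22 k12 add0r.
have o1 : orth_idem j1 k1 by split=> //; [apply: z | apply: z'].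
have o2 : orth_idem j2 k2 by split=> //; [apply: z | apply: z'].
split=> //; split; try exact: orth_idemD.
  by rewrite mulmxDl !mulmxDr j12 k12 (z j1 k2) // (z' k1 j2) // !addr0.
by rewrite mulmxDl !mulmxDr j21 k21 (z j2 k1) // (z' k2 j1) // !addr0.
Qed.

(** The two images are free of ranks [p] and [q], and their bases together form an invertible
    matrix. *)
Lemma orth_idem_frame p q (e1 e2 : 'M[R]_(p + q)) :
  orth_idem e1 e2 -> e1 + e2 = 1%:M ->
  cls e1 = cls (1%:M : 'M[R]_p) -> cls e2 = cls (1%:M : 'M[R]_q) ->
  exists Q Q' : 'M[R]_(p + q), [/\ Q *m Q' = 1%:M, Q' *m Q = 1%:M,
    Q *m e1 *m Q' = block_mx 1%:M 0 0 0 & Q *m e2 *m Q' = block_mx 0 0 0 1%:M].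
Proof.
move=> [e11 e22 e12 e21] e1De2 /cls_eq H1 /cls_eq H2.
have [y [x [yx xy [ey y1 xe x1]]]] := mvn_norm e11 (mulmx1 _) (H1 e11 (mulmx1 _)).
have [z [t [zt tz [ez z1 te t1]]]] := mvn_norm e22 (mulmx1 _) (H2 e22 (mulmx1 _)).
have ty : t *m y = 0 by rewrite -t1 -ey mulmxA -(mulmxA t) e21 mulmx0 mul0mx.
have xz : x *m z = 0 by rewrite -x1 -ez mulmxA -(mulmxA x) e12 mulmx0 mul0mx.
exists (col_mx x t), (row_mx y z).
rewrite mul_row_col mul_col_row xy tz xz ty yx zt -scalar_mx_block; split=> //.
  rewrite mul_col_mx mul_col_row x1 xy xz.
  by rewrite -t1 -(mulmxA t) e21 mulmx0 !mul0mx.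
rewrite mul_col_mx mul_col_row t1 tz ty.
by rewrite -x1 -(mulmxA x) e12 mulmx0 !mul0mx.
Qed.

(** The splitting of classes in [separative_diagonal] is lifted to idempotents. Source and target
    each become the sum of copies of R and of R^m, respected by [A]; bases of these summands provide
    [Q] and [P]. *)
Lemma separative_block_diagonal m (A B : 'M[R]_(1 + m)) : A *m B *m A = A ->
  exists (P P' Q Q' : 'M[R]_(1 + m)) a C,
  [/\ P *m P' = 1%:M /\ P' *m P = 1%:M, Q *m Q' = 1%:M /\ Q' *m Q = 1%:M
    & A = P *m block_mx a 0 0 C *m Q].
Proof.
(* [B *m A *m B] may replace [B], making [A] and [B] generalized inverses of each other. *)
wlog BAB : B / B *m A *m B = B => [IH ABA|ABA].
  have BABA : B *m A *m B *m A = B *m A.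
    by rewrite -(mulmxA B A B) -(mulmxA B _ A) ABA.
  by apply: (IH (B *m A *m B)); rewrite !mulmxA ?BABA // !ABA.
set u := cls (1%:M : 'M[R]_1).
have BA2 : B *m A *m (B *m A) = B *m A by rewrite mulmxA BAB.
have AB2 : A *m B *m (A *m B) = A *m B by rewrite mulmxA ABA.
have oBA : orth_idem (B *m A) (1%:M - B *m A) by apply: orth_idemB; rewrite ?mul1mx ?mulmx1.
have oAB : orth_idem (A *m B) (1%:M - A *m B) by apply: orth_idemB; rewrite ?mul1mx ?mulmx1.
have iE : cls (A *m B) = cls (B *m A) by apply/cls_eq => //; exists A, B.
have [||i1 [i2 [k1 [k2 [c1 [c2 [Di Dk Dc [ik1 ic1 ik2 ic2]]]]]]]] :=
    @separative_diagonal _ (Vmon_separative sepR) (Vmon_refinement exR) m u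
      (cls (B *m A)) (cls (1%:M - B *m A)) (cls (1%:M - A *m B)).
- by rewrite -cls_orth // addrC subrK cls_mx1 mulrS.
- by rewrite -iE -cls_orth // addrC subrK cls_mx1 mulrS.
have [_ iBA _ _] := oBA; have [_ iAB _ _] := oAB.
have [j1 [j2 [oj Dj Ej1 Ej2]]] := cls_split BA2 Di.
have [l1 [l2 [ol Dl El1 El2]]] := cls_split iBA Dk.
have [d1 [d2 [od Dd Ed1 Ed2]]] := cls_split iAB Dc.
have [j11 j22 j12 j21] := oj.
have jBA1 : j1 *m (B *m A) = j1 by rewrite Dj mulmxDr j11 j12 addr0.
have jBA2 : j2 *m (B *m A) = j2 by rewrite Dj mulmxDr j22 j21 add0r.
have BAj1 : B *m A *m j1 = j1 by rewrite Dj mulmxDl j11 j21 addr0.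
have BAj2 : B *m A *m j2 = j2 by rewrite Dj mulmxDl j22 j12 add0r.
(* The decomposition of [B *m A] is transported through [A] to one of [A *m B]. *)
pose f1 := A *m j1 *m B; pose f2 := A *m j2 *m B.
have ff (x y : 'M[R]_(1 + m)) : x *m (B *m A) = x ->
    A *m x *m B *m (A *m y *m B) = A *m (x *m y) *m B.
  by move=> {2}<-; rewrite !mulmxA.
have of12 : orth_idem f1 f2.
  by split; rewrite /f1 /f2 ff // ?j11 ?j22 ?j12 ?j21 ?mulmx0 ?mul0mx.
have Df : A *m B = f1 + f2.
  by rewrite /f1 /f2 -mulmxDl -mulmxDr -Dj !mulmxA ABA.
have fcls (j : 'M[R]_(1 + m)) : j *m j = j -> B *m A *m j = j -> j *m (B *m A) = j ->
    cls (A *m j *m B) = cls j.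
  move=> jj BAj jBA; apply/cls_eq => //; first by rewrite ff // jj.
  exists (A *m j), (j *m B); rewrite mulmxA -(mulmxA A) jj; split=> //.
  by rewrite mulmxA -(mulmxA j) jBA jj.
have [o1 o2 oe] := orth_idem_block oBA oj ol Dj Dl.
have [p1 p2 oq] := orth_idem_block oAB of12 od Df Dd.
have [||| Q [Q' [QQ' Q'Q Qe1 Qe2]]] := @orth_idem_frame 1 m _ _ oe.
- by rewrite addrACA -Dj -Dl addrC subrK.
- by rewrite cls_orth // Ej1 El1.
- by rewrite cls_orth // Ej2 El2 ik2 cls_mx1.
have [||| P' [P [P'P PP' Pf1 Pf2]]] := @orth_idem_frame 1 m _ _ oq.
- by rewrite addrACA -Df -Dd addrC subrK.
- by rewrite cls_orth // Ed1 fcls // Ej1.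
- by rewrite cls_orth // Ed2 fcls // Ej2 ic2 cls_mx1.
have Al x : (1%:M - B *m A) *m x = x -> A *m x = 0.
  by move=> <-; rewrite mulmxA mulmxBr mulmx1 mulmxA ABA subrr mul0mx.
have dA x : x *m (1%:M - A *m B) = x -> x *m A = 0.
  by move=> <-; rewrite -mulmxA mulmxBl mul1mx ABA subrr mulmx0.
have [l11 l22 l12 l21] := ol; have [d11 d22 d12 d21] := od.
have Al1 : A *m l1 = 0 by apply: Al; rewrite Dl mulmxDl l11 l21 addr0.
have Al2 : A *m l2 = 0 by apply: Al; rewrite Dl mulmxDl l22 l12 add0r.
have dA1 : d1 *m A = 0 by apply: dA; rewrite Dd mulmxDr d11 d12 addr0.
have dA2 : d2 *m A = 0 by apply: dA; rewrite Dd mulmxDr d22 d21 add0r.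
(* [A] kills [l1] and [l2] and carries [j1], [j2] into [f1], [f2], so the mixed blocks vanish. *)
have z12 : (f1 + d1) *m A *m (j2 + l2) = 0.
  rewrite mulmxDl dA1 addr0 mulmxDr -(mulmxA f1 A l2) Al2 mulmx0 addr0.
  by rewrite /f1 -!mulmxA (mulmxA B) BAj2 j12 mulmx0.
have z21 : (f2 + d2) *m A *m (j1 + l1) = 0.
  rewrite mulmxDl dA2 addr0 mulmxDr -(mulmxA f2 A l1) Al1 mulmx0 addr0.
  by rewrite /f2 -!mulmxA (mulmxA B) BAj1 j21 mulmx0.
pose M := P' *m A *m Q'.
pose ul : 'M[R]_(1 + m) := block_mx 1%:M 0 0 0.
pose dr : 'M[R]_(1 + m) := block_mx 0 0 0 1%:M.
have M12 : ul *m M *m dr = 0.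
  rewrite /ul /dr -Pf1 -Qe2 /M !mulmxA -(mulmxA _ P P') PP' mulmx1.
  by rewrite -(mulmxA _ Q' Q) Q'Q mulmx1 -2!(mulmxA P') z12 mulmx0 mul0mx.
have M21 : dr *m M *m ul = 0.
  rewrite /ul /dr -Pf2 -Qe1 /M !mulmxA -(mulmxA _ P P') PP' mulmx1.
  by rewrite -(mulmxA _ Q' Q) Q'Q mulmx1 -2!(mulmxA P') z21 mulmx0 mul0mx.
exists P, P', Q, Q', (ulsubmx M), (drsubmx M); split=> //.
have <- : M = block_mx (ulsubmx M) 0 0 (drsubmx M).
  rewrite -[LHS]submxK; congr block_mx.
    move: M12; rewrite /ul /dr -[M]submxK !mulmx_block.
    rewrite !(mul0mx, mulmx0, mulmx1, mul1mx, addr0, add0r).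
    by rewrite -block_mx0 => /eq_block_mx[_ + _ _]; rewrite block_mxKur.
  move: M21; rewrite /ul /dr -[M]submxK !mulmx_block.
  rewrite !(mul0mx, mulmx0, mulmx1, mul1mx, addr0, add0r).
  by rewrite -block_mx0 => /eq_block_mx[_ _ + _]; rewrite block_mxKdl.
by rewrite /M !mulmxA PP' mul1mx -mulmxA Q'Q mulmx1.
Qed.
End UnimodularRow.

Theorem theorem2p10 (R : pzRingType) (n : nat) (A : 'M[R]_n) :
  exchange_ring R -> separative R ->
  (exists B : 'M[R]_n, A *m B *m A = A) ->
  exists D : 'M[R]_n, elem_reach A D /\ is_diag_mx D.
Proof.
move=> exR sepR; elim: n A => [|[|m] IHn] A [B ABA].
- exists A; split; first exact: er_refl.
  by apply/is_diag_mxP => -[].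
- exists A; split; first exact: er_refl.
  by apply/is_diag_mxP => i j; rewrite !ord1.
have [P [P' [Q [Q' [a [C [[PP' P'P] [QQ' Q'Q] DA]]]]]]] :=
  @separative_block_diagonal R exR sepR m.+1 A B ABA.
(* Column operations are applied to the inverse [P']; inverting the result yields the row operations
   [U] that make [P] block diagonal. *)
have [V [v [w [D [D' [eV PV [vw wv] [DD' D'D]]]]]]] := separative_reduce_unit exR sepR P'P PP'.
have [U [eU VU UV]] := elementary_inv eV.
have [W [x [_ [E [_ [eW QW _ _]]]]]] := separative_reduce_unit exR sepR QQ' Q'Q.
have UP : U *m P = block_mx w 0 0 D'.
  rewrite -[LHS]mulmx1 [1%:M](_ : _ = block_mx v 0 0 D *m block_mx w 0 0 D').
    by rewrite -PV !mulmxA -(mulmxA U P) PP' mulmx1 UV mul1mx.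
  by rewrite mulmx_block !(mul0mx, mulmx0, addr0, add0r) vw DD' scalar_mx_block.
have DUAW : U *m A *m W = block_mx (w *m a *m x) 0 0 (D' *m C *m E).
  rewrite DA !mulmxA UP -(mulmxA _ Q) QW !mulmx_block.
  by rewrite !(mul0mx, mulmx0, addr0, add0r).
have [S [_ WS SW]] := elementary_inv eW.
have [K [reK diagK]] : exists K, elem_reach (D' *m C *m E) K /\ is_diag_mx K.
  (* Regularity passes to [U *m A *m W], with [T] in the role of [B], and then to its lower diagonal
     block. *)
  apply: IHn; pose T := S *m B *m V; exists (drsubmx T).
  have : U *m A *m W *m T *m (U *m A *m W) = U *m A *m W.
    rewrite /T !mulmxA -(mulmxA _ W S) WS mulmx1 -(mulmxA _ V U) VU mulmx1.
    by rewrite -(mulmxA U A B) -(mulmxA U _ A) ABA.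
  rewrite DUAW -[T]submxK !mulmx_block !(mul0mx, mulmx0, addr0, add0r).
  by case/eq_block_mx=> _ _ _; rewrite submxK.
exists (block_mx (w *m a *m x) 0 0 K); split.
  apply: elem_reach_trans (elementary_row A eU) _.
  apply: elem_reach_trans (elementary_col _ eW) _.
  by rewrite DUAW; apply: elem_reach_dr.
have dK := is_diag_mxP diagK; apply/is_diag_mxP => i j ij.
case: (@split_ordP 1 m.+1 i) ij => i' ->; case: (@split_ordP 1 m.+1 j) => j' -> ij.
- by move: ij; rewrite !ord1 eqxx.
- by apply: etrans (block_mxEur _ _ _ _ i' j') _; rewrite mxE.
- by apply: etrans (block_mxEdl _ _ _ _ i' j') _; rewrite mxE.
- by apply: etrans (block_mxEdr _ _ _ _ i' j') _; rewrite dK // -(eq_rshift 1).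
Qed.
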